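(* Let $P\subseteq\{3,4,\ldots,\omega\}$ be nonempty and let $W_P$ be the Ważewski dendrite associated with $P$. Then the dynamical system $(W_P,\mathrm{Homeo}(W_P))$ is rigid.
   Context: A dendrite is a compact, connected, locally connected, metrizable space $X$ such that any two points are the endpoints of a unique arc in $X$. The order of $x\in X$ is the number of connected components of $X\setminus\{x\}$ (written $\omega$ if this number is infinite); $x$ is a ramification point if its order is at least $3$. A subset of $X$ is arcwise dense if it meets every nondegenerate arc of $X$. For nonempty $P\subseteq\{3,4,\ldots,\omega\}$, the Ważewski dendrite $W_P$ is the (nondegenerate) dendrite, unique up to homeomorphism, such that every ramification point has order in $P$ and, for every $p\in P$, the set of ramification points of order $p$ is arcwise dense. The Ellis semigroup $E(X,G)$ of a continuous (faithful) action of a topological group $G$ on a compact space $X$ is the closure of $G$ (identified with $\{x\mapsto gx : g\in G\}$) in $X^X$ with the topology of pointwise convergence. The system $(X,G)$ is rigid if there is a sequence $(g_i)_{i<\omega}$ in $E(X,G)\setminus\{\mathrm{Id}_X\}$ with $g_i\to\mathrm{Id}_X$ pointwise. *)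

(* Defs.v *)
From HB Require Import structures.
From mathcomp Require Import all_boot all_order all_algebra finmap.
From mathcomp Require Import all_classical all_reals all_analysis.

Set Implicit Arguments.
Unset Strict Implicit.
Unset Printing Implicit Defensive.

Import Order.TTheory GRing.Theory Num.Theory.
Import numFieldNormedType.Exports.

Local Open Scope classical_set_scope.
Local Open Scope ring_scope.

Definition metrizable (R : realType) (X : topologicalType) : Prop :=
  exists d : X -> X -> R,
    [/\ forall x y, d x y = 0 <-> x = y,
        forall x y, d x y = d y x,
        forall x y z, d x z <= d x y + d y z
      & forall (x : X) (U : set X),
          nbhs x U <-> exists2 e : R, 0 < e & [set y | d x y < e] `<=` U].

Definition locally_connected (X : topologicalType) : Prop :=
  forall (x : X) (U : set X), nbhs x U ->
    exists V : set X, [/\ open V, V x, V `<=` U & connected V].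

(* [A] is an arc with endpoints [x] and [y]: [f] is a homeomorphism from [0, 1]
   onto the subspace [A], with inverse [g], sending 0 to [x] and 1 to [y]. Such
   arcs are always nondegenerate. *)
Definition is_arc (R : realType) (X : topologicalType) (A : set X) (x y : X)
    : Prop :=
  exists (f : R -> X) (g : X -> R),
    [/\ f @` `[0, 1] = A /\ {in `[0, 1], cancel f g},
        {within `[0, 1], continuous f},
        {within A, continuous g},
        f 0 = x
      & f 1 = y].

(* Two equal points are the endpoints of the degenerate arc only, so unique
   arcwise connectedness is a condition on pairs of distinct points. *)
Definition dendrite (R : realType) (X : topologicalType) : Prop :=
  [/\ compact [set: X], connected [set: X], locally_connected X, metrizable R X
    & forall x y : X, x <> y -> exists! A : set X, is_arc R A x y].

(* Orders take values in {0, 1, 2, ..., omega}; [None] stands for omega. *)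
Definition order_value := option nat.

Definition at_least3 (p : order_value) : bool :=
  if p is Some n then (3 <= n)%N else true.

Definition components (X : topologicalType) (A : set X) : set (set X) :=
  [set connected_component A y | y in A].

Definition point_order (X : topologicalType) (x : X) : order_value :=
  let C := components (~` [set x]) in
  if pselect (finite_set C) then Some #|` fset_set C| else None.

Definition ramification_point (X : topologicalType) (x : X) : Prop :=
  at_least3 (point_order x).

Definition arcwise_dense (R : realType) (X : topologicalType) (D : set X)
    : Prop :=
  forall (A : set X) (x y : X), is_arc R A x y -> A `&` D !=set0.

Definition wazewski_dendrite (R : realType) (P : set order_value)
    (X : topologicalType) : Prop :=
  [/\ dendrite R X,
      exists x y : X, x <> y,
      forall x : X, ramification_point x -> P (point_order x)
    & forall p, P p ->
        arcwise_dense R [set x : X | ramification_point x /\ point_order x = p]].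

(* A group acting faithfully on [X] is identified with the set [G] of the maps
   x |-> g x; the Ellis semigroup and rigidity do not involve its topology. *)
Definition ellis_semigroup (X : topologicalType) (G : set (X -> X))
    : set {ptws X -> X} :=
  closure (G : set {ptws X -> X}).

Definition rigid (X : topologicalType) (G : set (X -> X)) : Prop :=
  exists g : nat -> X -> X,
    (forall i, ellis_semigroup G (g i) /\ g i <> id) /\
    {ptws, g @ \oo --> (id : X -> X)}.

Definition Homeo (X : topologicalType) : set (X -> X) :=
  [set f | continuous f /\
    exists g : X -> X, [/\ continuous g, cancel f g & cancel g f]].

(* Main.v *)
Require Import Defs.
From HB Require Import structures.
From mathcomp Require Import all_boot all_order all_algebra finmap.
From mathcomp Require Import all_classical all_reals all_analysis.
From mathcomp Require Import lra zify.

(* It suffices to find nontrivial homeomorphisms with pairwise disjoint supports: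
   at each point all but one of them are trivial, so they converge pointwise to
   the identity. The supports are components [U] of complements of ramification
   points [z]. Rooting the dendrite at [z], the ramification points of [U] form a
   countable tree in which each order in [P] occurs densely, and the back-and-forth
   method gives an automorphism of this tree moving some point to another one of
   the same order. A point of [U] is determined by the set of ramification points
   below it, and the automorphism extends along these traces to a homeomorphism.

   The tree structure rests on one fact: an interior point of an arc separates the
   ends of the arc. If it did not, the component containing both ends, a connected
   open subset of a locally connected compact metric space, would contain another
   arc between them, against the uniqueness of arcs. *)

Set Implicit Arguments.
Unset Strict Implicit.
Unset Printing Implicit Defensive.

Import Order.TTheory GRing.Theory Num.Theory.
Import numFieldNormedType.Exports.

Local Open Scope classical_set_scope.
Local Open Scope ring_scope.

(** * Paths in locally connected compact metric spaces *)

(** Uniqueness in the definition of a dendrite speaks of arcs only, so two points of a connected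
    open set must be joined inside it by an arc, not just by a path. This is the Mazurkiewicz-Moore
    theorem: chains of small connected sets converge to a path, Zorn's lemma erases its loops, and
    the result is reparametrised injectively. After that most arguments take place in the rooted
    order: intervals are arcs, hence closed, and compactness gives meets and suprema of chains. The
    supports are whole branches because a branch is attached at the single point [z], so a self-map
    of it glues with the identity. The moved point goes to a strictly smaller one, which the density
    of its order provides. Infinitely many disjoint branches hang off one arc: each ramification
    point inside the arc has a component avoiding both ends. Orders are compared through finite
    lists of components, which treats finite and infinite orders alike. *)

Section ConnectedInduction.
Variable X : topologicalType.
Implicit Types C U : set X.

(* Any two points of a connected set are linked by a finite chain of members of
   an open cover. *)
Lemma connected_chain_ind C (V : X -> set X) (Q : X -> Prop) u :
  connected C -> C u -> Q u ->
  (forall w, C w -> open (V w) /\ V w w) ->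
  (forall w w', C w -> C w' -> Q w -> V w w' -> Q w') ->
  (forall w w', C w -> C w' -> Q w' -> V w w' -> Q w) ->
  forall w, C w -> Q w.
Proof.
move=> cC Cu Qu VP fwd bwd w Cw.
have E1 : C `&` Q = C `&` \bigcup_(w in C `&` Q) V w.
  apply/seteqP; split=> y [Cy].
    by move=> Qy; split=> //; exists y => //; have [] := VP _ Cy.
  by move=> [y' [Cy' Qy'] Vy]; split=> //; exact: (fwd y').
have E2 : C `&` Q = C `&` ~` \bigcup_(w in C `&` ~` Q) V w.
  apply/seteqP; split=> y [Cy].
    by move=> Qy; split=> // -[y' [Cy' nQ] Vy]; apply: nQ; exact: (bwd _ y).
  move=> nV; split=> //; apply: contrapT => nQ; apply: nV.
  by exists y => //; have [] := VP _ Cy.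
have : C `&` Q = C.
  apply: cC; first by exists u.
    exists (\bigcup_(w in C `&` Q) V w) => //.
    by apply: bigcup_open => i [Ci _]; have [] := VP _ Ci.
  exists (~` \bigcup_(w in C `&` ~` Q) V w) => //.
  by apply/open_closedC/bigcup_open => i [Ci _]; have [] := VP _ Ci.
by move=> E; have [] : (C `&` Q) w by rewrite E.
Qed.

End ConnectedInduction.

(** The body of [metrizable] with the metric named, so that [metrizable R X] is
    [exists d, is_metric d] by conversion. *)
Definition is_metric (R : realType) (X : topologicalType) (d : X -> X -> R) :=
  [/\ forall x y, d x y = 0 <-> x = y,
      forall x y, d x y = d y x,
      forall x y z, d x z <= d x y + d y z
    & forall (x : X) (U : set X),
        nbhs x U <-> exists2 e : R, 0 < e & [set y | d x y < e] `<=` U].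

Section Metric.
Variables (R : realType) (X : topologicalType) (d : X -> X -> R).
Hypothesis dm : is_metric d.

Lemma distxx x : d x x = 0. Proof. by case: dm => d0 _ _ _; apply: (d0 x x).2. Qed.
Lemma dist_eq0 x y : d x y = 0 -> x = y. Proof. by case: dm => d0 _ _ _ /d0. Qed.
Lemma distC x y : d x y = d y x. Proof. by case: dm. Qed.
Lemma dist_triangle y x z : d x z <= d x y + d y z. Proof. by case: dm. Qed.

Lemma dist_ge0 x y : 0 <= d x y.
Proof. by have := dist_triangle y x x; rewrite distxx (distC y x); lra. Qed.

Lemma dist_gt0 x y : x <> y -> 0 < d x y.
Proof.
by move=> xy; rewrite lt_neqAle dist_ge0 andbT eq_sym; apply/eqP => /dist_eq0.
Qed.

Lemma nbhs_dist x (e : R) : 0 < e -> nbhs x [set y | d x y < e].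
Proof. by case: dm => _ _ _ + e0 => ->; exists e. Qed.

Lemma nbhs_distE x (U : set X) : nbhs x U ->
  exists2 e : R, 0 < e & [set y | d x y < e] `<=` U.
Proof. by case: dm => _ _ _ ->. Qed.

Lemma dist_hausdorff : hausdorff_space X.
Proof.
move=> x y xy; apply: contrapT => /dist_gt0 dxy.
have h : 0 < d x y / 2 by lra.
have [z []] := xy _ _ (nbhs_dist x h) (nbhs_dist y h).
rewrite /= => xz yz; have := dist_triangle z x y; rewrite (distC z y); lra.
Qed.

Lemma continuous_dist (T : topologicalType) (f : T -> X) t :
  (forall e : R, 0 < e -> \forall s \near t, d (f t) (f s) < e) ->
  f @ t --> f t.
Proof.
move=> fe U /nbhs_distE[e e0 eU].
by apply: filterS (fe _ e0) => s /eU.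
Qed.

Lemma cvg_distP (T : topologicalType) (f : T -> X) t :
  f @ t --> f t ->
  forall e : R, 0 < e -> \forall s \near t, d (f t) (f s) < e.
Proof. by move=> fe e e0; exact: (fe _ (nbhs_dist (f t) e0)). Qed.

Definition rad (n : nat) : R := 2^-1 ^+ n.

Lemma rad_gt0 n : 0 < rad n. Proof. by rewrite exprn_gt0. Qed.
Lemma radS n : rad n.+1 = rad n / 2. Proof. by rewrite /rad exprSr. Qed.

Lemma rad_lt (e : R) : 0 < e -> exists n, rad n < e.
Proof.
move=> e0; have [n] : exists n, e^-1 < n%:R.
  exists (Num.truncn e^-1).+1; exact: truncnS_gt.
move=> ne; exists n; rewrite /rad exprVn invf_plt ?posrE ?exprn_gt0//.
apply: (lt_trans ne); rewrite -natrX ltr_nat; exact: ltn_expl.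
Qed.

(** A small connected set, rather than mere closeness: inside it the two points can be chained again
    at the next scale. *)
Definition link n u v := exists C : set X, [/\ connected C, C u, C v &
  forall w w', C w -> C w' -> d w w' < rad n].

Hypothesis lc : locally_connected X.

Lemma small_nbhs w n : exists V : set X, [/\ open V, V w, connected V &
  forall u v, V u -> V v -> d u v < rad n].
Proof.
have h := rad_gt0 n.+1.
have [V [oV Vw Vb cV]] := lc (nbhs_dist w h).
exists V; split=> // u v /Vb /= wu /Vb /= wv.
by have := dist_triangle w u v; rewrite (distC u w) radS in wu wv *; lra.
Qed.

Lemma linkxx n u : link n u u.
Proof.
exists [set u]; split=> //; first exact: connected1.
by move=> w w' -> ->; rewrite distxx rad_gt0.
Qed.

(** Chain induction inside the witness [C], which keeps the chain within [rad n] of [u]. The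
    sequence is eventually constant so that chains of different lengths can be padded to a common
    one. *)
Lemma link_refine n u v : link n u v -> exists (c : nat -> X) (k : nat),
  [/\ c 0%N = u, forall j, (k <= j)%N -> c j = v,
      forall j, link n.+1 (c j) (c j.+1) & forall j, d u (c j) < rad n].
Proof.
move=> [C [cC Cu Cv Cd]].
pose Q w := exists (c : nat -> X) (k : nat),
  [/\ c 0%N = u, forall j, (k <= j)%N -> c j = w,
      forall j, link n.+1 (c j) (c j.+1) & forall j, C (c j)].
suff : Q v.
  by move=> [c [k [c0 ck cl cC']]]; exists c, k; split=> // j; exact: Cd.
have [V VP] := choice (fun w => small_nbhs w n.+1).
have step w w' : C w -> C w' -> Q w -> link n.+1 w w' -> Q w'.
  move=> Cw Cw' [c [k [c0 ck cl cC']]] l.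
  exists (fun j => if (j <= k)%N then c j else w'), k.+1; split=> //.
  - by move=> j kj; rewrite leqNgt kj.
  - move=> j; case: ltngtP => //= jk.
    + exact: linkxx.
    + by rewrite jk ck.
  - by move=> j; case: ifP.
apply: (@connected_chain_ind _ C V Q u) => //.
- exists (fun=> u), 0%N; split=> // j; exact: linkxx.
- by move=> w _; have [] := VP w.
- move=> w w' Cw Cw' Qw Vw'; apply: (step w) => //.
  by have [oV Vw cV Vd] := VP w; exists (V w).
- move=> w w' Cw Cw' Qw Vw'; apply: (step w') => //.
  by have [oV Vw cV Vd] := VP w; exists (V w).
Qed.

(* Level [n] of the construction of a path: step functions with [s.2] steps
   whose consecutive values are [link]ed at scale [n]. *)
Definition stage u v n (s : (nat -> X) * nat) :=
  [/\ s.1 0%N = u, forall j, (s.2 <= j)%N -> s.1 j = v, (0 < s.2)%N &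
      forall j, link n (s.1 j) (s.1 j.+1)].

Definition refines n (s s' : (nat -> X) * nat) := exists2 N, (0 < N)%N &
  s'.2 = (s.2 * N)%N /\ forall j, d (s.1 (j %/ N)%N) (s'.1 j) < rad n.

Lemma stage_refine u v n s : stage u v n s ->
  exists s', stage u v n.+1 s' /\ refines n s s'.
Proof.
case: s => p M [/= p0 pM M0 pl].
have : forall i, exists c, exists k, [/\ c 0%N = p i, forall j, (k <= j)%N -> c j = p i.+1,
      forall j, link n.+1 (c j) (c j.+1), forall j, d (p i) (c j) < rad n &
      (M <= i)%N -> forall j, c j = v].
  move=> i; have [Mi|iM] := leqP M i.
    exists (fun=> v), 0%N; rewrite !pM ?leqW//; split=> //= j; first exact: linkxx.
    by rewrite distxx rad_gt0.
  by have [c [k [? ? ? ?]]] := link_refine (pl i); exists c, k; split=> //; lia.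
move=> /choice[c] /choice[k ck].
(* A common length for the chains of all the steps; the successor keeps it positive when every chain
   is trivial. *)
pose N := (\max_(i < M) k i).+1.
have N0 : (0 < N)%N by [].
have kN i : c i N = p i.+1.
  have [_ cik _ _ civ] := ck i.
  have [Mi|iM] := leqP M i; first by rewrite civ// pM// ltnW.
  rewrite cik//; apply: leqW; exact: (leq_bigmax (Ordinal iM)).
exists ((fun j => c (j %/ N) (j %% N))%N, (M * N)%N); split; last first.
  by exists N => //; split=> //= j; have [_ _ _ ? _] := ck (j %/ N)%N.
split=> /=.
- by rewrite div0n mod0n; have [-> _ _ _ _] := ck 0%N.
- move=> j Mj; have [_ _ _ _ ->//] := ck (j %/ N)%N.
  by rewrite leq_divRL.
- by rewrite muln_gt0 M0.
- move=> j; have [c0 _ cl _ _] := ck (j %/ N)%N.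
  (* The last substep of a block leads to the first value of the next block, because
     [c i N = p i.+1 = c i.+1 0]. *)
  have [jN|jN] := eqVneq (j %% N).+1 N.
    have -> : (j.+1 %/ N = (j %/ N).+1)%N.
      by rewrite {1}(divn_eq j N) -addnS jN divnMDl// divnn N0 addn1.
    have -> : (j.+1 %% N = 0)%N.
      by rewrite {1}(divn_eq j N) -addnS jN modnMDl modnn.
    by have [-> _ _ _ _] := ck (j %/ N).+1; have := cl (j %% N)%N; rewrite jN kN.
  have lt : ((j %% N).+1 < N)%N by rewrite ltn_neqAle jN ltn_pmod.
  have -> : (j.+1 %/ N = j %/ N)%N.
    by rewrite {1}(divn_eq j N) -addnS divnMDl// (divn_small lt) addn0.
  have -> : (j.+1 %% N = (j %% N).+1)%N.
    by rewrite {1}(divn_eq j N) -addnS modnMDl modn_small.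
  exact: cl.
Qed.

Lemma truncn_scale (M N : nat) (t : R) : (0 < N)%N ->
  (Num.truncn (t * (M * N)%:R) %/ N = Num.truncn (t * M%:R))%N.
Proof.
move=> N0; have [t0|t0] := ltP t 0.
  have neg (m : nat) : Num.truncn (t * m%:R) = 0%N.
    apply/eqP; rewrite -leqn0 truncn_le_nat.
    have : t * m%:R <= 0 by apply: mulr_le0_ge0; [exact: ltW|exact: ler0n].
    by move=> h; rewrite (le_lt_trans h)// ltr01.
  by rewrite !neg div0n.
apply/esym/truncn_def; rewrite natrM mulrA.
set x := t * M%:R; have x0 : 0 <= x by rewrite mulr_ge0.
have N0' : 0 < N%:R :> R by rewrite ltr0n.
have /andP[le lt] := truncn_itv (mulr_ge0 x0 (ler0n R N)).
set m := Num.truncn _ in le lt *.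
apply/andP; split.
  rewrite -(ler_pM2r N0'); apply: le_trans le.
  by rewrite -natrM ler_nat leq_divM.
rewrite -(ltr_pM2r N0'); apply: (lt_le_trans lt).
by rewrite -natrM ler_nat; exact: ltn_ceil.
Qed.

Hypothesis cX : compact [set: X].

(** Any cluster point will do: from index [n] on, the sequence stays in the closed ball of radius
    [r n] around [a n]. *)
Lemma compact_cauchy (a : nat -> X) (r : nat -> R) :
  (forall n m, (n <= m)%N -> d (a n) (a m) <= r n) ->
  exists l, forall n, d (a n) l <= r n.
Proof.
move=> ar.
have [|l [_ cl]] := cX (F := (a @ \oo)); first exact: filterT.
exists l => n; apply/ler_addgt0Pr => e e0.
have [] := cl [set a m | m in [set m | (n <= m)%N]] [set y | d l y < e].
- exists n => // m /= nm; by exists m.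
- exact: nbhs_dist.
move=> _ [[m /= nm <-]] lm; have := ar _ _ nm.
by have := dist_triangle (a m) (a n) l; rewrite (distC (a m) l); lra.
Qed.

(** Uniform limit of step functions. No stage is continuous, but the jumps of stage [i] are below
    [rad (n + i)], so they vanish in the limit. *)
Lemma link_path n u v : link n u v -> exists f : R -> X,
  [/\ continuous f, f 0 = u, f 1 = v & forall t, d u (f t) < 4 * rad n].
Proof.
move=> l.
pose s0 : (nat -> X) * nat := ((fun j => if j is 0 then u else v), 1)%N.
have st0 : stage u v n s0.
  split=> //; first by case.
  by case=> //= j; exact: linkxx.
have [F FP] : exists F : nat -> (nat -> X) * nat -> (nat -> X) * nat,
    forall i s, stage u v (n + i) s ->
      stage u v (n + i).+1 (F i s) /\ refines (n + i) s (F i s).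
  have : forall i, exists G : (nat -> X) * nat -> (nat -> X) * nat,
      forall s, stage u v (n + i) s ->
        stage u v (n + i).+1 (G s) /\ refines (n + i) s (G s).
    move=> i.
    have /choice[G GP] : forall s, exists s', stage u v (n + i) s ->
        stage u v (n + i).+1 s' /\ refines (n + i) s s'.
      move=> s; have [H|H] := pselect (stage u v (n + i) s); last by exists s.
      by have [s' ?] := stage_refine H; exists s'.
    by exists G.
  by move=> /choice[F FP]; exists F.
pose s := fix s i := if i is i'.+1 then F i' (s i') else s0.
have sP i : stage u v (n + i) (s i).
  elim: i => [|i IH /=]; first by rewrite addn0.
  by rewrite addnS; exact: (FP i _ IH).1.
have sr i : refines (n + i) (s i) (s i.+1) by exact: (FP i _ (sP i)).2.
pose f i (t : R) := (s i).1 (Num.truncn (t * (s i).2%:R)).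
have fS i t : d (f i t) (f i.+1 t) < rad (n + i).
  have [N N0 [E H]] := sr i.
  by have := H (Num.truncn (t * (s i.+1).2%:R)); rewrite E truncn_scale// -E.
(* Consecutive stages differ by less than [rad (n + i)]; the tail of the geometric series is
   [2 * rad (n + i)]. *)
have fC i j t : (i <= j)%N -> d (f i t) (f j t) <= 2 * rad (n + i).
  move=> /subnK <-; move: (j - i)%N => k; elim: k i => [|k IH] i.
    by rewrite add0n distxx; have := rad_gt0 (n + i); lra.
  have := IH i.+1; have := fS i t; rewrite addSnnS (addnS n i) radS.
  have := dist_triangle (f i.+1 t) (f i t) (f (k + i.+1)%N t); lra.
have [g gP] := choice (fun t => compact_cauchy (fun i j => @fC i j t)).
exists g; split.
- move=> t; apply: continuous_dist => e e0.
  (* Passing from [g] to stage [i] costs [2 * rad (n + i)] at each of the two times, and one jump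
     costs [rad (n + i)]. *)
  have [i ie] : exists i, rad i < e / 5 by apply: rad_lt; lra.
  have ni : rad (n + i) < e / 5.
    apply: le_lt_trans ie; rewrite /rad exprD ler_piMl ?exprn_ge0//.
    by rewrite exprn_ile1//; lra.
  have [p0 pM M0 pl] := sP i.
  set M := (s i).2 in M0.
  have M0' : 0 < M%:R :> R by rewrite ltr0n.
  have iM0 : 0 < M%:R^-1 :> R by rewrite invr_gt0.
  near=> r.
  have : `|t - r| < M%:R^-1.
    by near: r; exact: (@cvgr_dist_lt _ _ _ (nbhs t) _ id t).
  move=> tr; have {}tr : `|t * M%:R - r * M%:R| < 1.
    by rewrite -mulrBl normrM (gtr0_norm M0') -ltr_pdivlMr// div1r.
  have : d (f i t) (f i r) < rad (n + i).
    have aux (a b : R) : `|a - b| < 1 -> (Num.truncn a <= (Num.truncn b).+1)%N.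
      move=> ab; rewrite truncn_le_nat.
      have := truncnS_gt b; rewrite -!natr1; move: ab; rewrite ltr_norml.
      by move=> /andP[]; lra.
    have t1 := aux _ _ tr; rewrite distrC in tr; have t2 := aux _ _ tr.
    rewrite /f -/M; move: t1 t2.
    set a := Num.truncn _; set b := Num.truncn _ => ab ba.
    have [ab'|ab'|->] := ltngtP a b; last by rewrite distxx rad_gt0.
      have -> : b = a.+1 by lia.
      by have [C [_ ? ? ->]] := pl a.
    have -> : a = b.+1 by lia.
    by have [C [_ ? ? ->]] := pl b.
  have := gP t i; have := gP r i.
  have := dist_triangle (f i t) (g t) (g r); rewrite (distC (g t) (f i t)).
  by have := dist_triangle (f i r) (f i t) (g r); lra.
- apply/esym/dist_eq0/eqP; rewrite eq_le dist_ge0 andbT.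
  apply/ler_addgt0Pr => e e0; rewrite add0r.
  have [i ie] : exists i, rad i < e / 2 by apply: rad_lt; lra.
  have ni : rad (n + i) <= rad i.
    by rewrite /rad exprD ler_piMl ?exprn_ge0// exprn_ile1//; lra.
  have := gP 0 i; have [p0 _ _ _] := sP i; rewrite /f mul0r truncn0 p0; lra.
- apply/esym/dist_eq0/eqP; rewrite eq_le dist_ge0 andbT.
  apply/ler_addgt0Pr => e e0; rewrite add0r.
  have [i ie] : exists i, rad i < e / 2 by apply: rad_lt; lra.
  have ni : rad (n + i) <= rad i.
    by rewrite /rad exprD ler_piMl ?exprn_ge0// exprn_ile1//; lra.
  have := gP 1 i; have [_ pM _ _] := sP i; rewrite /f mul1r natrK pM//; lra.
- move=> t; have := gP t 0%N; rewrite addn0.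
  have r0 := rad_gt0 n.
  have : d u (f 0%N t) < rad n.
    rewrite /f /=; case: Num.truncn => [|_]; first by rewrite distxx.
    by have [C [_ ? ? ->]] := l.
  by have := dist_triangle (f 0%N t) u (g t); lra.
Unshelve. all: by end_near.
Qed.

End Metric.

(** * From paths to arcs *)

Section RealLine.
Variable R : realType.

(** Retraction of the line onto the unit interval; it lets paths be continuous on all of [R], away
    from subspace topologies. *)
Definition clamp (t : R) : R := Num.max 0 (Num.min 1 t).

Lemma clamp_itv t : 0 <= clamp t <= 1.
Proof. by rewrite /clamp le_max lexx /= ge_max ler01 ge_min lexx. Qed.

Lemma clamp_id t : 0 <= t <= 1 -> clamp t = t.
Proof. by move=> /andP[t0 t1]; rewrite /clamp min_r// max_r. Qed.

Lemma clamp_le0 t : t <= 0 -> clamp t = 0.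
Proof. by move=> t0; rewrite /clamp max_l// ge_min t0 orbT. Qed.

Lemma clamp_ge1 t : 1 <= t -> clamp t = 1.
Proof. by move=> t1; rewrite /clamp min_l// max_r. Qed.

Lemma clamp_le s t : s <= t -> clamp s <= clamp t.
Proof.
move=> st; rewrite /clamp ge_max !le_max lexx /=.
by rewrite [X in _ || X]le_min !ge_min lexx st /= !orbT.
Qed.

Lemma clamp_continuous : continuous clamp.
Proof.
move=> t; apply: continuous_max; first exact: cst_continuous.
by apply: continuous_min; [exact: cst_continuous|exact: id].
Qed.

(** The left end of the component of [O] around [m] is the largest point of the compact set of
    points of [[s, m]] outside [O]. *)
Lemma open_left_end (O : set R) m s : open O -> O m -> ~ O s -> s <= m ->
  exists a, [/\ s <= a < m, ~ O a & forall r, a < r <= m -> O r].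
Proof.
move=> oO Om nOs sm.
have K : compact (`[s, m] `&` ~` O).
  by apply: compact_closedI; [exact: segment_compact|exact: open_closedC].
have K0 : `[s, m] `&` ~` O !=set0.
  by exists s; split=> //=; rewrite in_itv /= lexx.
have [|a] := @compact_EVT_max _ _ id _ K0 K.
  by apply: continuous_subspaceT => x; exact: id.
rewrite inE => -[/=]; rewrite in_itv /= => /andP[sa am] nOa amax.
exists a; split=> //.
  by rewrite sa lt_neqAle am andbT; apply/eqP => E; apply: nOa; rewrite E.
move=> r /andP[ar rm]; apply: contrapT => nOr.
have := amax r; rewrite inE /= in_itv /= rm (le_trans sa (ltW ar)).
by move=> /(_ (conj isT nOr)); rewrite leNgt ar.
Qed.

Lemma open_right_end (O : set R) m t : open O -> O m -> ~ O t -> m <= t ->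
  exists b, [/\ m < b <= t, ~ O b & forall r, m <= r < b -> O r].
Proof.
move=> oO Om nOt mt.
have oO' : open (-%R @^-1` O).
  by apply: open_comp => // r _; exact: opp_continuous.
have [|||a [/andP[a1 a2] nOa aO]] := @open_left_end (-%R @^-1` O) (- m) (- t) oO'.
- by rewrite /preimage /= opprK.
- by rewrite /preimage /= opprK.
- by rewrite lerN2.
exists (- a); split=> //; first by rewrite ltrNr a2 lerNl.
move=> r /andP[mr ra]; have := aO (- r); rewrite /preimage /= opprK; apply.
by rewrite ltrNr ra lerN2.
Qed.

(** A finite subcover taken from a chain has a largest member. The sets [K] minus [O] form a filter
    base, whose cluster point would escape the cover. *)
Lemma compact_total_cover (T : topologicalType) (K : set T)
    (F : set (set T)) : compact K -> K !=set0 -> total_on F subset ->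
  (forall O, F O -> open O) -> K `<=` \bigcup_(O in F) O ->
  exists2 O, F O & K `<=` O.
Proof.
move=> cK [k0 Kk0] Ftot Fo KF; apply: contrapT => nex.
have [ O0 FO0 _] := KF _ Kk0.
pose G := filter_from F (fun O => K `\` O).
have GF : ProperFilter G.
  apply: filter_from_proper.
    apply: filter_from_filter; first by exists O0.
    move=> O1 O2 FO1 FO2; have [ O12|O21] := Ftot _ _ FO1 FO2.
      by exists O2 => // x [Kx nO]; split; split=> // /O12.
    by exists O1 => // x [Kx nO]; split; split=> // /O21.
  move=> O FO; apply: contrapT => K0; apply: nex; exists O => // x Kx.
  by apply: contrapT => nO; apply: K0; exists x.
have [|p [Kp cl]] := cK G; first by exists O0 => // x [].
have [ O FO Op] := KF _ Kp.
have [||x [[_ nOx] Ox]//] := cl (K `\` O) O; first by exists O.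
by apply: open_nbhs_nbhs; split; [exact: Fo|].
Qed.

End RealLine.

(** * Loop erasure *)

Section LoopErasure.
Variables (R : realType) (X : topologicalType) (d : X -> X -> R).
Hypothesis dm : is_metric d.

(* Collapsing a maximal open set of times [O], each component of which is a loop
   of [f], turns [f] into a path whose fibers are intervals. *)
Let loops (f : R -> X) (O : set R) :=
  [/\ open O, (forall r, O r -> 0 < r < 1) &
    forall s t, s < t -> ~ O s -> ~ O t -> (forall r, s < r < t -> O r) ->
      f s = f t].

(** A gap []s, t[] of the union is exhausted by gaps of members: compactness puts [[s + h, t - h]]
    into one member, whose component around it ends within [h] of [s] and of [t]. As [f] agrees at
    these ends, continuity gives [f s = f t]. *)
Let loops_bigcup f (F : set (set R)) : continuous f ->
  F `<=` loops f -> total_on F subset -> loops f (\bigcup_(O in F) O).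
Proof.
move=> cf Fl Ftot; split.
- by apply: bigcup_open => O /Fl[].
- by move=> r [ O /Fl[_ + _]]; exact.
move=> s t st nOs nOt O_st.
apply: (dist_eq0 dm); apply/eqP; rewrite eq_le (dist_ge0 dm) andbT.
apply/ler_addgt0Pr => e e0; rewrite add0r.
have e2 : 0 < e / 2 by lra.
have [d1 /= d10 Hs] := (nbhs_ballP _ _).1 (cvg_distP dm (cf s) e2).
have [d2 /= d20 Ht] := (nbhs_ballP _ _).1 (cvg_distP dm (cf t) e2).
pose h := Num.min (Num.min d1 d2) (t - s) / 3.
have [h0 [hd1 [hd2 hst]]] : 0 < h /\ (h < d1 /\ (h < d2 /\ s + h < t - h)).
  rewrite /h; set m := Num.min (Num.min _ _) _.
  have m0 : 0 < m by rewrite !lt_min d10 d20 subr_gt0 st.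
  have : m <= m by []; rewrite {2}/m !le_min => /andP[/andP[m1 m2] m3].
  by repeat split; lra.
have [ O FO KO] : exists2 O, F O & `[s + h, t - h]%classic `<=` O.
  apply: compact_total_cover => //.
  - exact: segment_compact.
  - by exists (s + h); rewrite /= in_itv /= lexx ltW.
  - by move=> O /Fl[].
  - by move=> r /=; rewrite in_itv /= => /andP[r1 r2]; apply: O_st; lra.
have [ oO O01 OP] := Fl _ FO.
have nO r : ~ (\bigcup_(O in F) O) r -> ~ O r by move=> nr Or; apply: nr; exists O.
have Osh : O (s + h) by apply: KO; rewrite /= in_itv /= lexx ltW.
have Oth : O (t - h) by apply: KO; rewrite /= in_itv /= lexx ltW.
have [||a [/andP[sa ah] nOa aO]] := @open_left_end _ _ _ s oO Osh.
- exact: nO.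
- lra.
have [||b [/andP[hb bt] nOb bO]] := @open_right_end _ _ _ t oO Oth.
- exact: nO.
- lra.
have fab : f a = f b.
  apply: OP => //; first lra.
  move=> r /andP[ar rb]; have [rs|sr] := leP r (s + h); first by apply: aO; lra.
  have [tr|rt] := leP (t - h) r; first by apply: bO; lra.
  by apply: KO; rewrite /= in_itv /=; lra.
have /= H1 := Hs a; have /= H2 := Ht b.
have {}H1 : d (f s) (f a) < e / 2.
  by apply: H1; rewrite /ball /= ler0_norm; lra.
have {}H2 : d (f t) (f b) < e / 2.
  by apply: H2; rewrite /ball /= ger0_norm; lra.
rewrite -fab in H2; have := dist_triangle dm (f a) (f s) (f t).
rewrite (distC dm (f a) (f t)); lra.
Qed.

Lemma monotone_path (f : R -> X) : continuous f ->
  exists phi : R -> X, [/\ continuous phi,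
    (forall t, t <= 0 -> phi t = f 0), (forall t, 1 <= t -> phi t = f 1),
    (forall t, exists t', phi t = f t') &
    forall s r t, s <= r <= t -> phi s = phi t -> phi r = phi s].
Proof.
move=> cf.
have [ O [[ oO O01 OP] Omax]] : exists O, loops f O /\
    forall O', O `<` O' -> ~ loops f O'.
  by apply: Zorn_bigcup => F; exact: loops_bigcup.
have nO0 : ~ O 0 by move=> /O01; lra.
have nO1 : ~ O 1 by move=> /O01; lra.
have gap t : O t -> exists a b, [/\ [/\ 0 <= a, a < t, t < b & b <= 1],
    ~ O a, ~ O b & forall r, a < r < b -> O r].
  move=> Ot; have /andP[t0 t1] := O01 _ Ot.
  have [a [/andP[a0 at_] nOa aO]] := open_left_end oO Ot nO0 (ltW t0).
  have [b [/andP[tb b1] nOb bO]] := open_right_end oO Ot nO1 (ltW t1).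
  exists a, b; split=> // r /andP[ar rb].
  have [rt|tr] := leP r t; first by apply: aO; lra.
  by apply: bO; lra.
have /choice[phi phiP] : forall t, exists x, (~ O t -> x = f t) /\
    (forall a b, ~ O a -> ~ O b -> a < t < b -> (forall r, a < r < b -> O r) ->
      x = f a /\ x = f b).
  move=> t.
  have [ Ot|nOt] := pselect (O t); last first.
    by exists (f t); split=> // a b _ _ /[swap] /[apply].
  have [a [b [[a0 at_ tb b1] nOa nOb abO]]] := gap _ Ot.
  exists (f a); split=> // a' b' nOa' nOb' /andP[at' tb'] abO'.
  have <- : a = a'.
    apply/eqP; rewrite eq_le !leNgt; apply/andP; split; apply/negP => aa.
      by apply: nOa; apply: abO'; lra.
    by apply: nOa'; apply: abO; lra.
  have <- : b = b'.
    apply/eqP; rewrite eq_le !leNgt; apply/andP; split; apply/negP => aa.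
      by apply: nOb'; apply: abO; lra.
    by apply: nOb; apply: abO'; lra.
  by split=> //; apply: OP => //; lra.
have phiN t : ~ O t -> phi t = f t by have [] := phiP t.
have phiG t a b : ~ O a -> ~ O b -> a < t < b -> (forall r, a < r < b -> O r) ->
    phi t = f a /\ phi t = f b by have [_] := phiP t; apply.
have phiG' t a b : ~ O a -> ~ O b -> a <= t <= b ->
    (forall r, a < r < b -> O r) -> a < b -> phi t = f a.
  move=> nOa nOb /andP[at_ tb] abO ab.
  have [->|ta] := eqVneq t a; first exact: phiN.
  have [->|tb'] := eqVneq t b; first by rewrite phiN//; apply/esym/OP.
  apply: (phiG t a b nOa nOb _ abO).1.
  by rewrite !lt_neqAle at_ tb tb' eq_sym ta.
have phi_cont : continuous phi.
  move=> t; apply: (continuous_dist dm) => e e0.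
  have [ Ot|nOt] := pselect (O t).
    have [a [b [[a0 at_ tb b1] nOa nOb abO]]] := gap _ Ot.
    have : \forall s \near t, s \in `]a, b[.
      by apply: near_in_itvoo; rewrite in_itv /= at_.
    apply: filterS => s; rewrite in_itv /= => asb.
    rewrite (phiG t a b nOa nOb _ abO).1 ?at_//.
    by rewrite (phiG s a b nOa nOb asb abO).1 (distxx dm).
  have [de /= de0 H] := (nbhs_ballP _ _).1 (cvg_distP dm (cf t) e0).
  apply/nbhs_ballP; exists de => //= s; rewrite /ball /= => ts.
  rewrite (phiN _ nOt).
  have [ Os|nOs] := pselect (O s); last by rewrite phiN//; exact: H.
  (* One end of the component around [s] lies between [s] and [t], hence within [de] of [t], and
     [phi s] is the value of [f] there. *)
  have [a [b [[a0 as_ sb b1] nOa nOb abO]]] := gap _ Os.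
  have [Ea Eb] := phiG s a b nOa nOb (andb_true_intro (conj as_ sb)) abO.
  have [ta|at_] := leP t a.
    rewrite Ea; apply: H; rewrite /ball /=; move: ts.
    by rewrite !ler0_norm; lra.
  have [bt|tb] := leP b t.
    rewrite Eb; apply: H; rewrite /ball /=; move: ts.
    by rewrite !ger0_norm; lra.
  by exfalso; apply: nOt; apply: abO; rewrite at_.
(* The ends of a loop avoiding [O] bound a component of [O], by maximality. *)
have fib s t : 0 <= s -> t <= 1 -> s < t -> ~ O s -> ~ O t -> f s = f t ->
    forall r, s < r < t -> O r.
  move=> s0 t1 st nOs nOt fst r rst; apply: contrapT => nOr.
  (* As [s] and [t] are outside [O], each component of the enlarged set is an old one or []s, t[]
     itself, so all components are still loops. *)
  apply: (Omax (O `|` `]s, t[%classic)).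
    split; first by move=> x; left.
    by move=> /(_ r) H; apply: nOr; apply: H; right; rewrite /= in_itv.
  split.
  - by apply: openU => //; exact: interval_open.
  - by move=> x [/O01//|]; rewrite /= in_itv /=; lra.
  move=> s' t' st' nOs' nOt' H.
  have nOs1 : ~ O s' by move=> ?; apply: nOs'; left.
  have nOt1 : ~ O t' by move=> ?; apply: nOt'; left.
  have nI x : ~ (O `|` `]s, t[%classic) x -> x <= s \/ t <= x.
    move=> nx; have [|sx] := leP x s; first by left.
    right; rewrite leNgt; apply/negP => xt; apply: nx; right.
    by rewrite /= in_itv /= sx.
  have [s's|ts'] := nI _ nOs'; last first.
    apply: OP => // x sxt; case: (H x sxt) => //.
    by rewrite /= in_itv /= => ?; lra.
  have [t's|tt'] := nI _ nOt'.
    apply: OP => // x sxt; case: (H x sxt) => //.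
    by rewrite /= in_itv /= => ?; lra.
  have -> : s' = s.
    apply/eqP; rewrite eq_le s's leNgt; apply/negP => ss.
    have [||] := H s; [by lra|by []|].
    by rewrite /= in_itv /= ltxx.
  suff -> : t' = t by [].
  apply/eqP; rewrite eq_le tt' andbT leNgt; apply/negP => ss.
  have [||] := H t; [by lra|by []|].
  by rewrite /= in_itv /= ltxx andbF.
have mono s r t : 0 <= s -> t <= 1 -> s <= r <= t -> phi s = phi t ->
    phi r = phi s.
  move=> s0 t1 /andP[sr rt] st.
  (* move [s] to the right, then [t] to the left, out of [O] *)
  have [s1 [ss1 nOs1 s01 Es]] : exists s1, [/\ s <= s1, ~ O s1, 0 <= s1 <= 1 &
      forall x, s <= x <= s1 -> phi x = phi s].
    have [ Os|nOs] := pselect (O s); last first.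
      by exists s; split=> //; [lra|move=> x xs; congr phi; lra].
    have [a [b [[a0 as_ sb b1] nOa nOb abO]]] := gap _ Os.
    exists b; split=> //; [lra|lra|move=> x /andP[sx xb]].
    by rewrite !(@phiG' _ a b)//; lra.
  have [t1' [tt1 nOt1 t01 Et]] : exists t1, [/\ t1 <= t, ~ O t1, 0 <= t1 <= 1 &
      forall x, t1 <= x <= t -> phi x = phi t].
    have [ Ot|nOt] := pselect (O t); last first.
      by exists t; split=> //; [lra|move=> x xs; congr phi; lra].
    have [a [b [[a0 as_ sb b1] nOa nOb abO]]] := gap _ Ot.
    exists a; split=> //; [lra|lra|move=> x /andP[sx xb]].
    by rewrite !(@phiG' _ a b)//; lra.
  have [rs1|s1r] := leP r s1; first by apply: Es; rewrite sr.
  have [tr|rt1] := leP t1' r; first by rewrite st; apply: Et; rewrite tr.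
  have st1 : s1 < t1' by lra.
  have f1 : f s1 = f t1'.
    by rewrite -!phiN// (Es s1) ?ss1 ?lexx// (Et t1') ?tt1 ?lexx.
  have H : forall r, s1 < r < t1' -> O r by apply: fib => //; lra.
  have -> : phi r = f s1 by apply: (phiG' r s1 t1' nOs1 nOt1 _ H st1); rewrite (ltW s1r) (ltW rt1).
  by rewrite -(phiN _ nOs1); apply: Es; rewrite ss1 lexx.
exists (phi \o @clamp R); split.
- move=> t; apply: continuous_comp; first exact: clamp_continuous.
  exact: phi_cont.
- by move=> t t0; rewrite /= clamp_le0// phiN.
- by move=> t t0; rewrite /= clamp_ge1// phiN.
- move=> t /=; have [ Ot|nOt] := pselect (O (clamp t)).
    have [a [b [[a0 as_ sb b1] nOa nOb abO]]] := gap _ Ot.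
    by exists a; apply: (phiG _ a b nOa nOb _ abO).1; rewrite as_.
  by exists (clamp t); exact: phiN.
- move=> s r t /andP[sr rt] /= E; apply: mono E.
  + by have /andP[] := clamp_itv s.
  + by have /andP[] := clamp_itv t.
  + by rewrite !clamp_le.
Qed.

End LoopErasure.

(** * Running suprema and the parameter of an arc *)

Section RunningSup.
Variable R : realType.
Variable u : R -> R.
Hypothesis cu : continuous u.
Hypothesis u01 : forall s, 0 <= u s <= 1.

Definition running_sup (t : R) : R := sup [set u s | s in [set s | s <= t]].

Let hs t : has_sup [set u s | s in [set s | s <= t]].
Proof.
split; first by exists (u t), t => //=.
by exists 1 => _ [s _ <-]; have /andP[] := u01 s.
Qed.

Lemma running_sup_ge s t : s <= t -> u s <= running_sup t.
Proof. by move=> st; apply: (sup_upper_bound (hs t)); exists s. Qed.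

Lemma running_sup_le t b : (forall s, s <= t -> u s <= b) -> running_sup t <= b.
Proof.
move=> H; apply: ge_sup; first by case: (hs t).
by move=> _ [s /= st <-]; exact: H.
Qed.

Lemma running_sup_mono s t : s <= t -> running_sup s <= running_sup t.
Proof.
by move=> st; apply: running_sup_le => r rs; apply: running_sup_ge; lra.
Qed.

Lemma running_sup01 t : 0 <= running_sup t <= 1.
Proof.
have /andP[u0 _] := u01 t; rewrite (le_trans u0) ?running_sup_ge//=.
by apply: running_sup_le => s _; have /andP[] := u01 s.
Qed.

Lemma running_sup_const s t : s <= t ->
  (forall r, s <= r <= t -> u r = u s) -> running_sup s = running_sup t.
Proof.
move=> st H; apply/eqP; rewrite eq_le running_sup_mono//=.
apply: running_sup_le => r rt; have [rs|sr] := leP r s.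
  exact: running_sup_ge.
have -> : u r = u s by apply: H; rewrite (ltW sr).
exact: running_sup_ge.
Qed.

(** The supremum grows between two times by at most the oscillation of [u] there, so it inherits the
    modulus of continuity of [u]. *)
Lemma running_sup_continuous : continuous running_sup.
Proof.
move=> t; apply/cvgrPdist_le => /= e e0.
have e2 : 0 < e / 2 by lra.
have : \forall s \near t, `|u t - u s| < e / 2 by move/cvgrPdist_lt: (@cu t); apply.
move=> /nbhs_ballP[del /= del0 H]; apply/nbhs_ballP; exists del => //= s.
rewrite /ball /= => ts.
have nearu (a b r : R) : `|t - a| < del -> `|t - b| < del -> a <= r <= b ->
    `|u t - u r| < e / 2.
  move=> ta tb arb; apply: H; rewrite /ball /=; move: ta tb; rewrite !ltr_norml.
  by move=> /andP[? ?] /andP[? ?]; lra.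
have tt : `|t - t| < del by rewrite subrr normr0.
have aux (a b : R) : a <= b -> `|t - a| < del -> `|t - b| < del ->
    running_sup b <= running_sup a + e.
  move=> ab ta tb; apply: running_sup_le => r rb; have [ra|ar] := leP r a.
    by have := running_sup_ge ra; lra.
  have ha := running_sup_ge (lexx a).
  have arb : a <= r <= b by rewrite (ltW ar).
  have aab : a <= a <= b by rewrite lexx.
  have := nearu a b r ta tb arb; have := nearu a b a ta tb aab.
  rewrite !ltr_norml => /andP[h1 h2] /andP[h3 h4]; lra.
have [st|ts'] := leP s t.
  rewrite ger0_norm ?subr_ge0 ?running_sup_mono//.
  by have := aux s t st ts tt; lra.
rewrite ler0_norm ?subr_le0 ?running_sup_mono ?(ltW ts')//.
by have := aux t s (ltW ts') tt ts; lra.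
Qed.

End RunningSup.

(** On a compact set [H] is a closed map, hence a quotient onto its image, and [phi \o sigma] is the
    map induced by [phi], whatever section [sigma] is chosen. It serves for an arc and, with path
    and parameter exchanged, for its inverse. *)
Lemma continuous_factor (T Y Z : topologicalType) (K : set T) (B : set Y)
    (H : T -> Y) (phi : T -> Z) (sigma : Y -> T) :
  compact K -> hausdorff_space Y -> continuous H -> continuous phi ->
  (forall s t, K s -> K t -> H s = H t -> phi s = phi t) ->
  (forall y, B y -> K (sigma y) /\ H (sigma y) = y) ->
  {within B, continuous (phi \o sigma)}.
Proof.
move=> cK hY cH cphi Hphi sP.
apply/subspace_continuousP => y By V; rewrite nbhsE => -[V' [oV' V'y] V'V].
have cK' : compact (K `&` phi @^-1` (~` V')).
  apply: compact_closedI => //; apply: preimage_closed; last exact: open_closedC.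
  by move=> t _; exact: cphi.
have clH : closed (H @` (K `&` phi @^-1` (~` V'))).
  apply: compact_closed => //; apply: continuous_compact => //.
  exact: continuous_subspaceT.
have [Ksy Hsy] := sP y By.
have : nbhs y (~` (H @` (K `&` phi @^-1` (~` V')))).
  apply: open_nbhs_nbhs; split; first exact: closed_openC.
  move=> [t [Kt nVt] Hty]; apply: nVt.
  by rewrite (Hphi t (sigma y)) ?Hty.
rewrite /fmap /= /within /=; apply: filterS => y' ny' By'.
have [Ksy' Hsy'] := sP y' By'.
apply: V'V; apply: contrapT => nV; apply: ny'.
by exists (sigma y').
Qed.

Section Arcs.
Variables (R : realType) (X : topologicalType) (d : X -> X -> R).
Hypothesis dm : is_metric d.

(* [h] weighs countably many running suprema of distances along [phi]; it
   increases exactly where [phi] moves, which makes it the arc parameter. *)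
Lemma arc_parameter (phi : R -> X) : continuous phi ->
  (forall s r t, s <= r <= t -> phi s = phi t -> phi r = phi s) ->
  exists h : R -> R, [/\ continuous h, {homo h : s t / s <= t} &
    forall s t, h s = h t <-> phi s = phi t].
Proof.
move=> cphi mono.
pose q n : R := if @choice.unpickle rat n is Some x then ratr x else 0.
(* Zero up to the rational time [q n], then the distance from [phi (q n)]; the cut at 1 makes the
   weighted series converge. *)
pose u n (s : R) : R := Num.min 1 (d (phi (q n)) (phi (Num.max s (q n)))).
have u01 n s : 0 <= u n s <= 1.
  by rewrite /u le_min ler01 (dist_ge0 dm) ge_min lexx.
have cu n : continuous (u n).
  move=> s; apply: continuous_min; first exact: cst_continuous.
  apply/cvgrPdist_lt => e e0.
  have cm : (fun s => phi (Num.max s (q n))) @ s --> phi (Num.max s (q n)).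
    apply: (continuous_comp (f := fun s => Num.max s (q n))); last exact: cphi.
    by apply: continuous_max; [exact: id|exact: cst_continuous].
  apply: filterS (cvg_distP dm cm e0) => s' Hs'.
  have := dist_triangle dm (phi (Num.max s (q n))) (phi (q n)) (phi (Num.max s' (q n))).
  have := dist_triangle dm (phi (Num.max s' (q n))) (phi (q n)) (phi (Num.max s (q n))).
  rewrite (distC dm (phi (Num.max s' (q n))) (phi (Num.max s (q n)))).
  by move=> ? ?; rewrite ltr_norml; lra.
pose M n := running_sup (u n).
pose S N t := \sum_(n < N) rad R n.+1 * M n t.
(* The weights with indices from [N] to [N + k - 1] sum to [rad R N - rad R (N + k)], so the series
   is within [rad R N] of its partial sum [S N]. *)
have S_step N k t : S N t <= S (N + k)%N t <= S N t + rad R N - rad R (N + k).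
  elim: k => [|k /andP[IH1 IH2]]; first by rewrite addn0; lra.
  have -> : S (N + k.+1)%N t =
      S (N + k)%N t + rad R (N + k).+1 * M (N + k)%N t.
    by rewrite addnS /S big_ord_recr.
  have /andP[M0 M1] := running_sup01 (u01 (N + k)%N) t.
  have r0 := rad_gt0 R (N + k).+1.
  have rM0 : 0 <= rad R (N + k).+1 * M (N + k)%N t by rewrite mulr_ge0 ?(ltW r0).
  have rM1 : rad R (N + k).+1 * M (N + k)%N t <= rad R (N + k).+1.
    by rewrite ler_piMr ?(ltW r0).
  by rewrite addnS; rewrite radS in rM0 rM1 *; lra.
have S_mono N k t : S N t <= S (N + k)%N t by have /andP[] := S_step N k t.
have S_close N N' t : S N' t <= S N t + rad R N.
  have [NN'|N'N] := leqP N N'.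
    rewrite -(subnKC NN'); have /andP[_] := S_step N (N' - N)%N t.
    by have := rad_gt0 R (N + (N' - N)); lra.
  have := S_mono N' (N - N')%N t; rewrite subnKC ?(ltnW N'N)//.
  by have := rad_gt0 R N; lra.
pose h t := sup [set S N t | N in [set: nat]].
have hsup t : has_sup [set S N t | N in [set: nat]].
  split; first by exists (S 0%N t), 0%N.
  by exists (S 0%N t + rad R 0) => _ [N _ <-].
have h_ge N t : S N t <= h t by apply: (sup_upper_bound (hsup t)); exists N.
have h_le N t : h t <= S N t + rad R N.
  by apply: ge_sup; [case: (hsup t)|move=> _ [N' _ <-]].
have Slip N s t : s <= t -> S N s <= S N t.
  move=> st; apply: ler_sum => n _; rewrite ler_pM2l ?rad_gt0//.
  exact: running_sup_mono.
have hmono : {homo h : s t / s <= t}.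
  move=> s t st; apply: ge_sup; first by case: (hsup s).
  by move=> _ [N _ <-]; apply: le_trans (h_ge N t); exact: Slip.
have hconst s t : s <= t -> phi s = phi t -> h s = h t.
  move=> st E; suff SE N : S N s = S N t.
    by rewrite /h; congr sup; apply/seteqP; split=> _ [N _ <-]; exists N.
  apply: eq_bigr => n _; congr (_ * _); apply: running_sup_const => // r rst.
  have /andP[sr rt] := rst.
  rewrite /u; congr (Num.min 1 (d _ _)).
  have [qs|sq] := leP (q n) s.
    by rewrite !max_l//; [exact: mono rst E|lra].
  have [qr|rq] := leP (q n) r; last by [].
  rewrite (mono s r t rst E); apply/esym/(mono s _ t) => //.
  by rewrite (ltW sq); lra.
have hstrict s t : s < t -> phi s <> phi t -> h s < h t.
  move=> st E.
  (* A rational time just after [s] still has [phi (q n) <> phi t]. The running supremum of index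
     [n] is then zero at [s] and positive at [t]. *)
  have [n [nq E']] : exists n, s < q n < t /\ phi (q n) <> phi t.
    have dst := dist_gt0 dm E.
    have [del /= del0 H] := (nbhs_ballP _ _).1 (cvg_distP dm (cphi s) dst).
    have smin : s < Num.min t (s + del) by rewrite lt_min st ltrDl.
    have [x] := rat_in_itvoo smin; rewrite in_itv /= lt_min => /andP[sx /andP[xt xd]].
    exists (choice.pickle x); rewrite /q choice.pickleK sx xt; split=> // E'.
    have := H (ratr x); rewrite /ball /= E' ltxx ler0_norm; last by lra.
    by move=> /(_ ltac:(lra)).
  have Ms : M n s <= 0.
    apply: (running_sup_le (u01 n)) => r rs; rewrite /u max_r; last by lra.
    by rewrite (distxx dm) ge_min lexx orbT.
  have Mt : 0 < M n t.
    apply: lt_le_trans (running_sup_ge (u01 n) (lexx t)).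
    rewrite /u max_l; last by lra.
    by rewrite lt_min ltr01; exact: dist_gt0.
  pose c := rad R n.+1 * (M n t - M n s).
  have c0 : 0 < c by rewrite mulr_gt0 ?rad_gt0//; lra.
  have [N0 N0c] := rad_lt c0.
  (* Large enough for the partial sum to include term [n] and for the remainder [rad R N] to stay
     below the gain [c] of that term. *)
  pose N := (N0 + n.+1)%N.
  have rN : rad R N < c.
    apply: le_lt_trans N0c; rewrite /rad /N exprD ler_piMr ?exprn_ge0//.
    by rewrite exprn_ile1//; lra.
  have : S N s + c <= S N t.
    have nN : (n < N)%N by rewrite /N; lia.
    rewrite /S (bigD1 (Ordinal nN)) //= [X in _ <= X](bigD1 (Ordinal nN)) //=.
    rewrite /c mulrBr.
    suff : \sum_(i < N | i != Ordinal nN) rad R i.+1 * M i s <=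
      \sum_(i < N | i != Ordinal nN) rad R i.+1 * M i t by lra.
    apply: ler_sum => i _; rewrite ler_pM2l ?rad_gt0//.
    by apply: running_sup_mono => //; exact: ltW.
  by have := h_le N s; have := h_ge N t; lra.
exists h; split=> //.
- move=> t; apply/cvgrPdist_lt => e e0.
  have [N Ne] : exists N, rad R N < e / 2 by apply: rad_lt; lra.
  have cS : continuous (S N).
    rewrite /S; elim: N {Ne} => [|N IH].
      by under eq_fun do rewrite big_ord0; exact: cst_continuous.
    under eq_fun do rewrite big_ord_recr /=.
    move=> x; apply: cvgD; first exact: IH.
    apply: cvgM; first exact: cvg_cst.
    exact: running_sup_continuous.
  have e2 : 0 < e / 2 by lra.
  have : \forall s \near t, `|S N t - S N s| < e / 2.
    by move/cvgrPdist_lt: (@cS t); apply.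
  apply: filterS => s; rewrite !ltr_norml => /andP[? ?].
  by have := h_le N s; have := h_ge N s; have := h_le N t; have := h_ge N t; lra.
- move=> s t; split.
    move=> hst; apply: contrapT => E; have [st|ts|st] := ltgtP s t.
    + by have := hstrict _ _ st E; rewrite hst ltxx.
    + by have := hstrict _ _ ts (fun e => E (esym e)); rewrite hst ltxx.
    + by apply: E; rewrite st.
  move=> E; have [st|ts] := leP s t; first exact: hconst.
  by apply/esym/hconst => //; exact: ltW.
Qed.
End Arcs.

(** * Arcs inside paths, and paths inside connected open sets *)

Section ArcExistence.
Variables (R : realType) (X : topologicalType) (d : X -> X -> R).
Hypothesis dm : is_metric d.

(** After loop erasure, the normalised parameter [H] and [phi] have the same fibres. So [phi]
    induces a bijection from the unit interval onto its image, with inverse induced by [H]. *)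
Lemma arc_of_path (f : R -> X) : continuous f -> f 0 <> f 1 ->
  exists2 A, is_arc R A (f 0) (f 1) & A `<=` range f.
Proof.
move=> cf f01.
have [phi [cphi phi0 phi1 phif mono]] := monotone_path dm cf.
have [h [ch hmono hphi]] := arc_parameter dm cphi mono.
have p0 : phi 0 = f 0 by exact: phi0.
have p1 : phi 1 = f 1 by exact: phi1.
have h01 : h 0 < h 1.
  rewrite lt_neqAle hmono ?ler01// andbT; apply/eqP => /hphi.
  by rewrite p0 p1.
have L0 : 0 < h 1 - h 0 by lra.
pose H t := (h t - h 0) / (h 1 - h 0).
have cH : continuous H.
  move=> t; apply: cvgM; last exact: cvg_cst.
  by apply: cvgB; [exact: ch|exact: cvg_cst].
have HP s t : H s = H t <-> phi s = phi t.
  rewrite -hphi /H; split=> [|-> //].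
  by move/(mulIf (invr_neq0 (lt0r_neq0 L0)))/addIr.
have H0 : H 0 = 0 by rewrite /H subrr mul0r.
have H1 : H 1 = 1 by rewrite /H divff// lt0r_neq0.
have Hin t : `[0, 1]%classic t -> `[0, 1]%classic (H t).
  rewrite /= !in_itv /= => /andP[t0 t1].
  rewrite /H divr_ge0 ?subr_ge0 ?(ltW h01) ?hmono//=.
  by rewrite ler_pdivrMr// mul1r lerB// hmono.
have /choice[sigma sP] : forall w, exists t,
    `[0, 1]%classic w -> `[0, 1]%classic t /\ H t = w.
  move=> w; have [w01|nw] := pselect (`[0, 1]%classic w); last by exists 0.
  have [||t t01 Ht] := @IVT R H 0 1 w ler01.
  - exact: continuous_subspaceT.
  - move: w01; rewrite /= in_itv /= H0 H1 => /andP[w0 w1].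
    by rewrite ge_min w0 le_max w1 orbT.
  by exists t.
pose A := phi @` `[0, 1]%classic.
have /choice[tau tP] : forall a, exists t,
    A a -> `[0, 1]%classic t /\ phi t = a.
  move=> a; have [[t t01 <-]|nA] := pselect (A a); last by exists 0.
  by exists t.
have c01 := @segment_compact R 0 1.
exists A; last by move=> _ [t _ <-]; have [t' ->] := phif t; exists t'.
exists (phi \o sigma), (H \o tau).
have I0 : `[0, 1]%classic (0 : R) by rewrite /= in_itv /= lexx ler01.
have I1 : `[0, 1]%classic (1 : R) by rewrite /= in_itv /= lexx ler01.
split.
- split.
    apply/seteqP; split=> [_ [w w01 <-]|_ [t t01 <-]].
      by exists (sigma w) => //; have [] := sP w w01.
    exists (H t); first exact: Hin.
    by apply/HP; have [_ ->] := sP _ (Hin _ t01).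
  move=> w w01; have {}w01 : `[0, 1]%classic w by exact: w01.
  have [sw Hs] := sP w w01; rewrite /= -[RHS]Hs; apply/HP.
  by apply: (tP _ _).2; exists (sigma w).
- apply: (continuous_factor (H := H) c01) => //.
  + by move=> s t _ _ /HP.
- apply: (continuous_factor (H := phi) c01) => //.
  + exact: (dist_hausdorff dm).
  + by move=> s t _ _ /HP.
- by rewrite -p0; apply/HP; rewrite (sP 0 I0).2.
- by rewrite -p1; apply/HP; rewrite (sP 1 I1).2.
Qed.

Definition path_in (U : set X) u v :=
  exists f : R -> X, [/\ continuous f, f 0 = u, f 1 = v & forall t, U (f t)].

Lemma path_in_refl (U : set X) u : U u -> path_in U u u.
Proof. by move=> Uu; exists (fun=> u); split=> // t; exact: cvg_cst. Qed.

Lemma path_in_sym U u v : path_in U u v -> path_in U v u.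
Proof.
move=> [f [cf f0 f1 Uf]]; exists (f \o (fun t : R => 1 - t)); split=> //=.
- move=> t; apply: continuous_comp; last exact: cf.
  by apply: cvgB; [exact: cvg_cst|exact: cvg_id].
- by rewrite subr0.
- by rewrite subrr.
Qed.

Lemma path_in_trans U u v w : path_in U u v -> path_in U v w -> path_in U u w.
Proof.
have half1 : (1 <= 2^-1 :> R) = false by apply/negbTE; rewrite -ltNge; lra.
have e21 : 2 * 1 - 1 = 1 :> R by lra.
have half : 2 * 2^-1 = 1 :> R by rewrite divff.
have le_half (t : R) : (t <= 2^-1) = false -> 2^-1 <= t by lra.
have eq_half (t : R) : 2^-1 <= t -> t <= 2^-1 -> t = 2^-1 by lra.
move=> [f [cf f0 f1 Uf]] [g [cg g0 g1 Ug]].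
pose F t := if t <= 2^-1 then f (2 * t) else g (2 * t - 1).
have c2 : continuous (f \o (fun t : R => 2 * t)).
  move=> t; apply: continuous_comp; last exact: cf.
  by apply: cvgM; [exact: cvg_cst|exact: cvg_id].
have c3 : continuous (g \o (fun t : R => 2 * t - 1)).
  move=> t; apply: continuous_comp; last exact: cg.
  by apply: cvgB; [apply: cvgM; [exact: cvg_cst|exact: cvg_id]|exact: cvg_cst].
exists F; split.
- apply/continuous_closedP => C cC.
  have -> : F @^-1` C = (`]-oo, 2^-1]%classic `&` (fun t => f (2 * t)) @^-1` C) `|`
      (`[2^-1, +oo[%classic `&` (fun t => g (2 * t - 1)) @^-1` C).
    apply/seteqP; split=> t; rewrite /preimage /F /= !in_itv /= andbT.
      by case: ifP => [t2|/le_half t2]; [left|right].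
    case=> -[t2]; first by rewrite t2.
    by case: ifP => // /(eq_half _ t2) ->; rewrite half subrr g0 f1.
  apply: closedU; apply: closedI.
  - exact: interval_closed.
  - by move/continuous_closedP: c2; apply.
  - exact: interval_closed.
  - by move/continuous_closedP: c3; apply.
- by rewrite /F invr_ge0 ler0n mulr0.
- by rewrite /F half1 e21.
- by move=> t; rewrite /F; case: ifP.
Qed.

Hypothesis lc : locally_connected X.
Hypothesis cX : compact [set: X].

Lemma open_connected_path U u v :
  open U -> connected U -> U u -> U v -> path_in U u v.
Proof.
move=> oU cU Uu Uv.
have /choice[V VP] : forall w, exists V : set X, U w -> [/\ open V, V w &
    forall w', V w' -> path_in U w w'].
  move=> w; have [Uw|nUw] := pselect (U w); last by exists set0.
  have [e e0 eU] : exists2 e : R, 0 < e & [set y | d w y < e] `<=` U.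
    by apply: nbhs_distE => //; exact: open_nbhs_nbhs.
  (* The path given by [link_path] strays less than [4 * rad R n] from [w]. *)
  have [n ne] : exists n, rad R n < e / 4 by apply: rad_lt; lra.
  have [V [oV Vw cV Vd]] := small_nbhs dm lc w n.
  exists V => _; split=> // w' Vw'.
  have [|f [cf f0 f1 fd]] := @link_path _ _ _ dm lc cX n w w'; first by exists V.
  by exists f; split=> // t; apply: eU; rewrite /=; have := fd t; lra.
apply: (@connected_chain_ind _ U V (path_in U u) u) => //.
- exact: path_in_refl.
- by move=> w Uw; have [] := VP w Uw.
- move=> w w' Uw _ uw Vw'; apply: path_in_trans uw _.
  by have [_ _] := VP w Uw; apply.
- move=> w w' Uw _ uw Vw'; apply: path_in_trans uw _; apply: path_in_sym.
  by have [_ _] := VP w Uw; apply.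
Qed.

End ArcExistence.

(** * Components and the rooted order *)

Section Components.
Variable X : topologicalType.
Hypothesis cT : connected [set: X].
Hypothesis lc : locally_connected X.
Hypothesis hX : hausdorff_space X.

Definition cc (c x : X) : set X := connected_component (~` [set c]) x.

Lemma cc_refl c x : x <> c -> cc c x x.
Proof. by move=> xc; exact: connected_component_refl. Qed.

Lemma cc_neq c x y : cc c x y -> y <> c.
Proof. by move/connected_component_sub. Qed.

Lemma cc_out c : cc c c = set0.
Proof. by apply: connected_component_out => /(_ erefl). Qed.

Lemma cc_sym c x y : cc c x y -> cc c y x.
Proof. exact: connected_component_sym. Qed.

Lemma cc_trans y c x w : cc c x y -> cc c y w -> cc c x w.
Proof. exact: connected_component_trans. Qed.

Lemma cc_max c x (B : set X) : connected B -> B x -> ~ B c -> B `<=` cc c x.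
Proof.
move=> cB Bx nBc; apply: connected_component_max => // y By.
by move=> yc; apply: nBc; rewrite -yc.
Qed.

Lemma open_neq (c : X) : open (~` [set c]).
Proof.
by apply/closed_openC/accessible_closed_set1/hausdorff_accessible.
Qed.

Lemma cc_open c x : open (cc c x).
Proof.
rewrite openE => y xy; have yc := cc_neq xy.
have [|V [oV Vy Vc cV]] := lc (x := y) (U := ~` [set c]).
  by apply: open_nbhs_nbhs; split=> //; exact: open_neq.
rewrite /interior; apply: filterS (open_nbhs_nbhs (conj oV Vy)) => w Vw.
apply: cc_trans xy _; apply: cc_max Vw => //.
by move=> /Vc; apply.
Qed.

(** The component is open; if [c] were not in its closure it would also be closed, against the
    connectedness of [X]. *)
Lemma cc_closure c x : x <> c -> connected (cc c x `|` [set c]).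
Proof.
move=> xc.
have clc : closure (cc c x) c.
  apply: contrapT => nc.
  have E : closure (cc c x) = cc c x.
    apply/seteqP; split; last exact: subset_closure.
    apply: cc_max => //; first exact/connected_closure/component_connected.
    exact/subset_closure/cc_refl.
  have : cc c x = [set: X].
    apply: cT; first by exists x; exact: cc_refl.
      by exists (cc c x); [exact: cc_open|rewrite setTI].
    by exists (cc c x); [rewrite -E; exact: closed_closure|rewrite setTI].
  by move=> E'; have := @cc_neq c x c; rewrite E'; apply.
apply: contrapT => /connectedPn[B [B0 BE sB]].
have cC : connected (cc c x) by exact: component_connected.
have sub : cc c x `<=` B false `|` B true by rewrite -BE => y; left.
have key b : ~ (cc c x `<=` B b).
  move=> CB.
  have [y By] := B0 (~~ b).
  have yc : y = c.
    have : (cc c x `|` [set c]) y by rewrite BE; case: b {CB} By => /=; [left|right].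
    case=> // /CB Bby; exfalso; move/separated_disjoint: sB.
    by apply/eqP/set0P; exists y; case: b {CB} By Bby => /= ? ?; split.
  have clB : closure (B b) y by rewrite yc; exact: closureS CB _ clc.
  move: sB; rewrite /separated => -[s1 s2].
  case: b {CB} By clB => /= By clB.
    by move: s2; apply/eqP/set0P; exists y.
  by move: s1; apply/eqP/set0P; exists y.
by have [/key|/key] := connected_subset sB sub cC.
Qed.

(** The complement is the union of the other components, each with [c] attached, and all of these
    pieces meet at [c]. *)
Lemma cc_compl_connected c x : connected (~` cc c x).
Proof.
have [->|/eqP xc] := eqVneq x c; first by rewrite cc_out setC0.
have -> : ~` cc c x = \bigcup_(y in ~` cc c x) ((cc c y) `|` [set c]).
  apply/seteqP; split=> [y nxy|y [w nxw [wy|->]]].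
  - exists y => //; have [->|/eqP yc] := eqVneq y c; first by right.
    by left; exact: cc_refl.
  - by move=> xy; apply: nxw; apply: cc_trans xy _; exact: cc_sym.
  - by move=> /cc_neq.
apply: bigcup_connected.
  by exists c => y _; right.
move=> y nxy; have [->|/eqP yc] := eqVneq y c; last exact: cc_closure.
by rewrite cc_out set0U; exact: connected1.
Qed.

(* The order of [X] rooted at [z]: [tle z a b] when [a] lies on the arc from [z]
   to [b]. For [a = z] the component is empty, so [z] is the least element. *)
Definition tle (z a b : X) := ~ cc a z b.

Lemma tle_refl z a : tle z a a. Proof. by move=> /cc_neq. Qed.

Lemma tle_root z a : tle z z a. Proof. by rewrite /tle cc_out. Qed.

Lemma tle_root_eq z a : tle z a z -> a = z.
Proof. by move=> az; apply: contrapT => na; apply/az/cc_refl => /esym. Qed.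

Lemma cc_ncomp z a b : a <> b -> ~ cc a z b -> a <> z -> cc b a z.
Proof.
move=> ab nab az; apply: (cc_max (@cc_closure a z (nesym az))).
- by right.
- by case=> // /esym.
- by left; apply: cc_refl; exact: nesym.
Qed.

Lemma tle_antisym z a b : tle z a b -> tle z b a -> a = b.
Proof.
move=> lab lba; apply: contrapT => ab.
have [az|/eqP az] := eqVneq a z.
  by move: lba; rewrite az => /tle_root_eq E; apply: ab; rewrite az E.
by apply: lba; apply: cc_sym; exact: cc_ncomp.
Qed.

Lemma tle_trans z a b e : tle z a b -> tle z b e -> tle z a e.
Proof.
move=> lab lbe; have [->|/eqP az] := eqVneq a z; first exact: tle_root.
have [<-//|/eqP ba] := eqVneq b a.
move=> aze; apply: lbe.
apply: (cc_max (@cc_closure a z (nesym az))).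
- by left; apply: cc_refl; exact: nesym.
- by case.
- by left.
Qed.

Lemma tle_cc_sub z a b : tle z a b -> cc a z `<=` cc b z.
Proof. by move=> ab e ae; apply: contrapT => /(tle_trans ab). Qed.

(** The points above [a] form the complement of [cc a z], which is connected and here misses [b]. *)
Lemma up_cc z a b e : ~ tle z a b -> tle z a e -> cc b a e.
Proof.
move=> nab ae; apply: (cc_max (@cc_compl_connected a z)) => //.
exact: tle_refl.
Qed.

(** The tree property. Were [a] and [b] incomparable, the up-set of [a] would join [a] to [e] off
    [b]; since [a] lies in [cc b z], so would [e]. *)
Lemma tle_total z a b e : tle z a e -> tle z b e -> tle z a b \/ tle z b a.
Proof.
move=> ae be; apply: contrapT => /not_orP[nab nba].
have bae := up_cc nab ae.
apply: be; apply: cc_trans bae.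
by have := up_cc nba (@tle_refl z b); move: nba => /contrapT.
Qed.

Lemma up_closed z a : closed (~` cc a z).
Proof. exact/open_closedC/cc_open. Qed.

(** Change of root: an arc is ordered from its own endpoint [m], the tree from [z]. *)
Lemma between_tle z m a e : tle z m a -> tle m e a -> tle z m e /\ tle z e a.
Proof.
move=> ma mea.
have [->|/eqP em] := eqVneq e m; first by split=> //; exact: tle_refl.
have me : tle z m e.
  by apply: contrapT => nme; apply: mea; exact: up_cc ma.
split=> // eza; apply: mea.
have [mz|/eqP mz] := eqVneq m z; first by rewrite mz.
apply: cc_trans eza; apply: cc_ncomp => //; exact: nesym.
Qed.

Lemma cc_tle z e a b : cc e a b -> tle z e a -> tle z e b.
Proof. by move=> ab ea eb; apply: ea; apply: cc_trans eb _; exact: cc_sym. Qed.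

Lemma tle_cc z t a x y : tle z a t -> t <> a -> tle z t x -> tle z t y -> cc a x y.
Proof.
move=> at_ ta tx ty; apply: (cc_max (@cc_compl_connected t z)) => //.
by move=> nta; apply: ta; apply: tle_antisym at_.
Qed.

End Components.

(** * Dendrites *)

Section Dendrite.
Variables (R : realType) (X : topologicalType).
Hypothesis dend : dendrite R X.
Implicit Types (x y z a b e m : X) (A : set X).

Let cX : compact [set: X]. Proof. by case: dend. Qed.
Let cT : connected [set: X]. Proof. by case: dend. Qed.
Let lc : locally_connected X. Proof. by case: dend. Qed.
Let dist_ex : exists d : X -> X -> R, is_metric d. Proof. by case: dend. Qed.

Lemma dendrite_hausdorff : hausdorff_space X.
Proof. by have [d dm] := dist_ex; exact: dist_hausdorff dm. Qed.

Let hX := dendrite_hausdorff.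

Lemma arc_path A x y : is_arc R A x y -> exists f : R -> X,
  [/\ continuous f, f 0 = x, f 1 = y,
      f @` `[0, 1] = A /\ forall t, A (f t) &
      forall s t, 0 <= s <= 1 -> 0 <= t <= 1 -> f s = f t -> s = t].
Proof.
move=> [f [g [[fA fg] cf cg f0 f1]]].
have I (t : R) : `[0, 1]%classic (clamp t) by rewrite /= in_itv /= clamp_itv.
exists (f \o @clamp R); split.
- move=> t; move/subspace_continuousP: cf => /(_ _ (I t)) cf.
  apply: cvg_comp cf => V; rewrite /within /= => nV.
  have H : nbhs t (@clamp R @^-1` [set s | `[0, 1]%classic s -> V s]).
    exact: (@clamp_continuous R t _ nV).
  by apply: (@filterS _ (nbhs t)) H => s Hs; exact: (Hs (I s)).
- by rewrite /= clamp_le0.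
- by rewrite /= clamp_ge1.
- split; last by move=> t; rewrite -fA; exists (clamp t).
  rewrite -fA; apply/seteqP; split=> _ [t t01 <-].
    by exists (clamp t).
  by exists t => //=; rewrite clamp_id.
- move=> s t s01 t01; rewrite /= !clamp_id// => /(congr1 g).
  by rewrite !fg// in_itv.
Qed.

Lemma arc_connected A x y : is_arc R A x y -> connected A.
Proof.
move=> /arc_path[f [cf _ _ [<- _] _]].
apply: connected_continuous_connected; first exact: segment_connected.
exact: continuous_subspaceT.
Qed.

Lemma arc_closed A x y : is_arc R A x y -> closed A.
Proof.
move=> /arc_path[f [cf _ _ [<- _] _]].
apply: compact_closed => //; apply: continuous_compact.
  exact: continuous_subspaceT.
exact: segment_compact.
Qed.

Lemma arc_ends A x y : is_arc R A x y -> A x /\ A y.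
Proof. by move=> /arc_path[f [cf <- <- [_ fA] _]]. Qed.

Lemma arc_ex x y : x <> y -> exists A, is_arc R A x y.
Proof. by case: dend => _ _ _ _ u /u[A [? _]]; exists A. Qed.

(* Otherwise [x] and [y] would be joined by an arc in the component of
   [X \ {c}], besides [A]. *)
Lemma arc_separates A x y c : is_arc R A x y -> A c -> c <> x -> c <> y ->
  ~ cc c x y.
Proof.
move=> Axy Ac cx cy xy.
have [d dm] := dist_ex.
have xy_neq : x <> y.
  have [f [_ f0 f1 _ inj]] := arc_path Axy => E.
  by have := inj 0 1; rewrite f0 f1 !lexx ler01 => /(_ isT isT E) /eqP; rewrite eq_sym oner_eq0.
have [f [cf f0 f1 fU]] : path_in R (cc c x) x y.
  apply: (open_connected_path dm) => //.
  - exact: cc_open.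
  - exact: component_connected.
  - by apply: cc_refl; exact: nesym.
have [|B Bxy Bf] := arc_of_path dm cf; first by rewrite f0 f1.
rewrite f0 f1 in Bxy.
have [A' [_ u]] : exists! A, is_arc R A x y by case: dend => _ _ _ _; apply.
have [t _ tc] : range f c by apply: Bf; rewrite -(u _ Bxy) (u _ Axy).
by have := fU t; rewrite tc => /cc_neq.
Qed.

(** Points of the arc separate its ends; a point off the arc does not, since [A] is then a connected
    set avoiding it. *)
Lemma arcE A x y : is_arc R A x y -> A = [set a | tle x a y].
Proof.
move=> Axy; have [Ax Ay] := arc_ends Axy; apply/seteqP; split=> a /=.
  move=> Aa; have [->|/eqP ax] := eqVneq a x; first exact: tle_root.
  have [->|/eqP ay] := eqVneq a y; first exact: tle_refl.
  exact: arc_separates Axy _ _ _.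
move=> ay; apply: contrapT => nAa; apply: ay.
by apply: cc_max Ay => //; exact: arc_connected Axy.
Qed.

Lemma down_closed z a : closed [set e | tle z e a].
Proof.
have [<-|/eqP za] := eqVneq z a.
  rewrite (_ : [set _ | _] = [set z]).
    exact/accessible_closed_set1/hausdorff_accessible.
  by apply/seteqP; split=> [e /tle_root_eq|e ->] //=; exact: tle_root.
by have [A Aza] := arc_ex za; rewrite -(arcE Aza); exact: arc_closed Aza.
Qed.

Lemma sub_compact A : closed A -> compact A.
Proof. by move=> cA; exact: subclosed_compact cA cX _. Qed.

(** The common lower bounds form a compact chain [L]. Without a greatest element, the open sets
    [cc e z] of points not above [e] would cover [L]; one of them would suffice, yet it misses its
    own [e]. *)
Lemma meet_ex z a b : exists m, [/\ tle z m a, tle z m b &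
  forall e, tle z e a -> tle z e b -> tle z e m].
Proof.
pose L := [set e | tle z e a] `&` [set e | tle z e b].
have [m [[ma mb] mU]] : exists m, L m /\ ~ (\bigcup_(e in L) cc e z) m.
  apply: contrapT => nex.
  have [|||||_ [e Le <-] LO] := @compact_total_cover X L [set cc e z | e in L].
  - apply: sub_compact. apply: closedI; exact: down_closed.
  - by exists z; split; exact: tle_root.
  - move=> _ _ [e Le <-] [e' Le' <-].
    have [ee'|e'e] := tle_total cT lc hX Le.1 Le'.1; [left|right].
    + exact: tle_cc_sub.
    + exact: tle_cc_sub.
  - by move=> _ [e Le <-]; exact: cc_open.
  - move=> e Le; apply: contrapT => ne; apply: nex; exists e; split=> //.
    by move=> [e' Le' ee']; apply: ne; exists (cc e' z) => //; exists e'.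
  - by apply: (@tle_refl _ z e); exact: LO.
exists m; split=> // e ea eb em; apply: mU; exists e => //; split=> //.
Qed.

Lemma near_root m a (N : set X) : m <> a -> nbhs m N ->
  exists e, [/\ N e, e <> m, e <> a & tle m e a].
Proof.
move=> ma nN; have [A Ama] := arc_ex ma.
have [f [cf f0 f1 [_ fA] inj]] := arc_path Ama.
have : \forall t \near (0 : R), N (f t) by apply: cf; rewrite f0.
move=> /nbhs_ballP[del /= del0 H].
pose t := Num.min (del / 2) (1 / 2).
have [t0 [tdel t1]] : 0 < t /\ (t < del /\ t < 1).
  rewrite /t lt_min !gt_min; split; first by apply/andP; split; lra.
  split; first by rewrite ltr_pdivrMr//; apply/orP; left; lra.
  by apply/orP; right; lra.
have h1 : 0 <= t <= 1 by rewrite !ltW.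
exists (f t); split.
- by apply: H; rewrite /ball /= sub0r normrN gtr0_norm.
- by rewrite -f0 => /inj; rewrite lexx ler01 => /(_ h1 isT) E; rewrite E ltxx in t0.
- by rewrite -f1 => /inj; rewrite lexx ler01 => /(_ h1 isT) E; rewrite E ltxx in t1.
- by have := fA t; rewrite (arcE Ama).
Qed.

(** Otherwise the arc from [a] to [b] is a closed set avoiding [m]. A point [e] just above [m]
    towards [a] then avoids it too, so [e] does not separate [a] from [b] and lies below both,
    against the maximality of [m]. *)
Lemma meet_separates z a b m : ~ tle z a b -> ~ tle z b a ->
  tle z m a -> tle z m b -> (forall e, tle z e a -> tle z e b -> tle z e m) ->
  ~ cc m a b.
Proof.
move=> nab nba ma mb mP mab.
have ab : a <> b by move=> E; apply: nab; rewrite E; exact: tle_refl.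
have ma_neq : m <> a by move=> E; apply: nab; rewrite -E.
have [A Aab] := arc_ex ab.
have nAm : ~ A m by rewrite (arcE Aab); apply.
have nN : nbhs m (~` A).
  by apply: open_nbhs_nbhs; split=> //; apply/closed_openC/(arc_closed Aab).
have [e [nAe em ea mea]] := near_root ma_neq nN.
have [zme zea] := between_tle cT lc hX ma mea.
have eab : cc e a b.
  by apply: contrapT => H; apply: nAe; rewrite (arcE Aab).
have zeb := cc_tle eab zea.
by apply: em; apply: (tle_antisym cT lc hX _ zme); exact: mP.
Qed.

(** Compactness gives an upper bound [u0]. The upper bounds below [u0] form a compact chain, which
    has a least element; an arbitrary upper bound [u] is compared with it through the meet of [u]
    and [u0]. *)
Lemma sup_ex z (C : set X) :
  (forall a b, C a -> C b -> tle z a b \/ tle z b a) ->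
  exists s, (forall a, C a -> tle z a s) /\
    forall u, (forall a, C a -> tle z a u) -> tle z s u.
Proof.
move=> Ctot.
have [u0 u0P] : exists u, forall a, C a -> tle z a u.
  apply: contrapT => nex.
  have [|||||_ [e Ce <-] LO] := @compact_total_cover X setT [set cc e z | e in C].
  - exact: cX.
  - by exists z.
  - move=> _ _ [e Le <-] [e' Le' <-].
    have [ee'|e'e] := Ctot _ _ Le Le'; [left|right].
    + exact: tle_cc_sub.
    + exact: tle_cc_sub.
  - by move=> _ [e Le <-]; exact: cc_open.
  - move=> u _; apply: contrapT => nu; apply: nex; exists u => a Ca au.
    by apply: nu; exists (cc a z) => //; exists a.
  - by apply: (@tle_refl _ z e); exact: LO.
pose K := [set u | tle z u u0] `&` \bigcap_(a in C) ~` cc a z.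
have [s [[su0 sC] smin]] : exists s, K s /\ forall v, K v -> tle z s v.
  apply: contrapT => nex.
  have [|||||_ [v Kv <-] LO] :=
      @compact_total_cover X K [set ~` [set e | tle z e v] | v in K].
  - apply: sub_compact; apply: closedI; first exact: down_closed.
    by apply: closed_bigI => a _; exact: up_closed.
  - by exists u0; split=> /=; [exact: tle_refl|exact: u0P].
  - move=> _ _ [e [Le _] <-] [e' [Le' _] <-].
    have [ee'|e'e] := tle_total cT lc hX Le Le'; [right|left];
      by apply: subsetC => x /= xe; exact: tle_trans xe _.
  - by move=> _ [v _ <-]; apply: closed_openC; exact: down_closed.
  - move=> s Ks; apply: contrapT => ns; apply: nex; exists s; split=> // v Kv.
    apply: contrapT => sv; apply: ns.
    by exists (~` [set e | tle z e v]) => //; exists v.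
  - by apply: (LO v Kv); exact: tle_refl.
exists s; split=> // u uP.
have [m [mu mu0 mP]] := meet_ex z u u0.
apply: tle_trans mu => //; apply: smin; split=> // a Ca.
by apply: mP; [exact: uP|exact: u0P].
Qed.

Variable D : set X.
Hypothesis Dd : arcwise_dense R D.

Lemma dense_between a b : a <> b -> exists e, [/\ D e, e <> a, e <> b & tle a e b].
Proof.
move=> ab; have [A Aab] := arc_ex ab; have [d dm] := dist_ex.
have [f [cf f0 f1 [_ fA] inj]] := arc_path Aab.
(* [h] runs through [[1/3, 2/3]]: density is applied to a subarc that avoids both ends. *)
pose h t : R := (1 + clamp t) / 3.
have h01 t : 0 < h t < 1.
  by have := clamp_itv t; rewrite /h => /andP[? ?]; apply/andP; split; lra.
have h01' t : 0 <= h t <= 1 by have /andP[? ?] := h01 t; rewrite !ltW.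
have cfh : continuous (f \o h).
  move=> t; apply: continuous_comp; last exact: cf.
  apply: cvgM; last exact: cvg_cst.
  by apply: cvgD; [exact: cvg_cst|exact: clamp_continuous].
have [|B Bab Bf] := arc_of_path dm cfh.
  move=> /inj => /(_ (h01' _) (h01' _)); rewrite /h clamp_le0// clamp_ge1//.
  by lra.
have [e [Be De]] := Dd Bab.
have [t _ te] := Bf e Be; exists e; split=> //.
- rewrite -te -f0 => /inj => /(_ (h01' _)); rewrite lexx ler01 => /(_ isT) E.
  by have := h01 t; rewrite E ltxx.
- rewrite -te -f1 => /inj => /(_ (h01' _)); rewrite lexx ler01 => /(_ isT) E.
  by have := h01 t; rewrite E ltxx andbF.
- by have := fA (h t); rewrite (arcE Aab) -te.
Qed.

Lemma dense_lt z a b : tle z a b -> a <> b ->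
  exists e, [/\ D e, e <> a, e <> b, tle z a e & tle z e b].
Proof.
move=> zab ab; have [e [De ea eb aeb]] := dense_between ab.
by have [? ?] := between_tle cT lc hX zab aeb; exists e.
Qed.

End Dendrite.

(** * Back and forth *)

Section BackAndForth.
Variables (T : eqType) (C : Type) (le : T -> T -> Prop) (E : set T).
Variable col : T -> C.

Hypothesis le_rr : forall a, le a a.
Hypothesis le_tr : forall b a c, le a b -> le b c -> le a c.
Hypothesis le_as : forall a b, le a b -> le b a -> a = b.
Hypothesis le_lin : forall a b e, le a e -> le b e -> le a b \/ le b a.

Let lt a b := le a b /\ a <> b.

Definition glb m a b :=
  [/\ le m a, le m b & forall e, E e -> le e a -> le e b -> le e m].

Hypothesis meetE : forall a b, E a -> E b -> exists2 m, E m & glb m a b.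
Hypothesis denseE : forall a b c, E a -> E b -> E c -> lt a b ->
  exists e, [/\ E e, col e = col c, lt a e & lt e b].
Hypothesis belowE : forall b c, E b -> E c ->
  exists e, [/\ E e, col e = col c & lt e b].

Definition same_cone e x y := exists t, [/\ E t, lt e t, le t x & le t y].

(** Points in pairwise distinct cones above [e]. Comparing the possible lengths of such lists
    compares numbers of cones without deciding whether they are finite. *)
Definition cone_reps e (r : seq T) := [/\ uniq r,
  forall x, x \in r -> E x /\ lt e x &
  forall x y, x \in r -> y \in r -> same_cone e x y -> x = y].

Hypothesis conesE : forall a b, E a -> E b -> col a = col b ->
  forall r, cone_reps a r -> exists2 r', cone_reps b r' & size r' = size r.

Lemma lt_le_tr b a c : lt a b -> le b c -> lt a c.
Proof.
move=> [ab nab] bc; split; first exact: le_tr bc.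
by move=> ac; apply: nab; apply: le_as => //; rewrite ac.
Qed.

Lemma le_lt_tr b a c : le a b -> lt b c -> lt a c.
Proof.
move=> ab [bc nbc]; split; first exact: le_tr bc.
by move=> ac; apply: nbc; apply: le_as => //; rewrite -ac.
Qed.

Lemma lt_nle a b : lt a b -> ~ le b a.
Proof. by move=> [ab nab] ba; apply: nab; exact: le_as. Qed.

Lemma same_cone_trans e y x w :
  same_cone e x y -> same_cone e y w -> same_cone e x w.
Proof.
move=> [t [Et et tx ty]] [t' [Et' et' ty' tw]].
have [tt'|t't] := le_lin ty ty'.
  by exists t; split=> //; exact: le_tr tw.
by exists t'; split=> //; exact: le_tr tx.
Qed.

Lemma same_cone_sym e x y : same_cone e x y -> same_cone e y x.
Proof. by move=> [t [? ? ? ?]]; exists t. Qed.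

Lemma directed_max (U : eqType) (r : U -> U -> Prop) (Q : U -> Prop) (s : seq U) :
  (forall x, r x x) -> (forall y x w, r x y -> r y w -> r x w) ->
  (exists2 x, x \in s & Q x) ->
  (forall x y, x \in s -> y \in s -> Q x -> Q y ->
    exists m, [/\ m \in s, Q m, r x m & r y m]) ->
  exists m, [/\ m \in s, Q m & forall x, x \in s -> Q x -> r x m].
Proof.
move=> rr rt [x0 x0s Qx0] dir.
have H : forall s' : seq U, {subset s' <= s} ->
    exists m, [/\ m \in s, Q m & forall x, x \in s' -> Q x -> r x m].
  elim=> [_|x s' IH sub]; first by exists x0.
  have [|m [ms Qm mP]] := IH; first by move=> y ys; apply: sub; rewrite inE ys orbT.
  have [Qx|nQx] := pselect (Q x); last first.
    exists m; split=> // y; rewrite inE => /orP[/eqP -> //|]; exact: mP.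
  have [|m' [m's Qm' xm' mm']] := dir x m _ ms Qx Qm.
    by apply: sub; rewrite inE eqxx.
  exists m'; split=> // y; rewrite inE => /orP[/eqP -> //|ys' Qy].
  by apply: rt mm'; exact: mP.
by have [m [ms Qm mP]] := H s (fun _ => id); exists m.
Qed.

(* Domain and image are closed under meets, so that the position of a new point
   is determined by its neighbours in the domain. *)
Definition partial_iso (s : seq (T * T)) :=
  [/\ forall p, p \in s -> [/\ E p.1, E p.2 & col p.1 = col p.2],
      forall p q, p \in s -> q \in s -> (le p.1 q.1 <-> le p.2 q.2) &
      forall p q, p \in s -> q \in s ->
        exists r, [/\ r \in s, glb r.1 p.1 q.1 & glb r.2 p.2 q.2]].

Lemma glbC m a b : glb m a b -> glb m b a.
Proof. by move=> [ma mb mP]; split=> // e Ee eb ea; exact: mP. Qed.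

Lemma glb_l a b : le a b -> glb a a b.
Proof. by split. Qed.

Lemma partial_iso_cons s d d' : partial_iso s -> E d -> E d' -> col d = col d' ->
  (forall p, p \in s -> (le p.1 d <-> le p.2 d') /\ (le d p.1 <-> le d' p.2)) ->
  (forall p, p \in s -> exists r,
    [/\ r \in (d, d') :: s, glb r.1 p.1 d & glb r.2 p.2 d']) ->
  partial_iso ((d, d') :: s).
Proof.
move=> [sE sle sglb] Ed Ed' cdd' lep glbp; split.
- by move=> p; rewrite inE => /orP[/eqP -> //|]; exact: sE.
- move=> p q; rewrite !inE => /orP[/eqP ->|ps] /orP[/eqP ->|qs] //=.
  + by have [] := lep _ qs.
  + by have [] := lep _ ps.
  + exact: sle.
- move=> p q; rewrite !inE => /orP[/eqP ->|ps] /orP[/eqP ->|qs] /=.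
  + by exists (d, d'); rewrite inE eqxx; split=> //; exact: glb_l.
  + by have [r [rs r1 r2]] := glbp _ qs; exists r; split=> //; exact: glbC.
  + by have [r [rs r1 r2]] := glbp _ ps; exists r.
  + have [r [rs r1 r2]] := sglb _ _ ps qs; exists r; split=> //.
    by rewrite inE rs orbT.
Qed.

Lemma partial_iso_swap s :
  partial_iso s -> partial_iso [seq (p.2, p.1) | p <- s].
Proof.
move=> [sE sle sglb]; split.
- by move=> _ /mapP[p ps ->] /=; have [? ? ->] := sE _ ps.
- by move=> _ _ /mapP[p ps ->] /mapP[q qs ->] /=; apply: iff_sym; exact: sle.
- move=> _ _ /mapP[p ps ->] /mapP[q qs ->] /=.
  have [r [rs r1 r2]] := sglb _ _ ps qs; exists (r.2, r.1); split=> //.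
  by apply/mapP; exists r.
Qed.

(** Closure under meets gives a least domain point [p1] above [e]; the image [e'] goes below that of
    [p1] and above those of the domain points below [e]. Any other [p] is handled through its meet
    with [p1], which is comparable with [e] as both lie below [p1]. *)
Lemma extend_below s p0 e : partial_iso s -> p0 \in s -> E e -> le e p0.1 ->
  (forall p, p \in s -> p.1 <> e) ->
  exists e', partial_iso ((e, e') :: s).
Proof.
move=> PIs p0s Ee ep0 ne; have [sE sle sglb] := PIs.
have [||||p1 [p1s ep1 p1min]] := @directed_max _ (fun p q : T * T => le q.1 p.1)
    (fun p => le e p.1) s.
- by move=> p; exact: le_rr.
- by move=> q p r qp rq; exact: le_tr qp.
- by exists p0.
- move=> p q ps qs ep eq_; have [r [rs [rp rq rP] _]] := sglb _ _ ps qs.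
  by exists r; split=> //; exact: rP.
have [Ep1 Ep1' _] := sE _ p1s.
have ltep1 : lt e p1.1 by split=> // ?; apply: (ne _ p1s).
have [e' [Ee' ce' e'p1 K]] : exists e', [/\ E e', col e' = col e, lt e' p1.2 &
    forall p, p \in s -> le p.1 e -> lt p.2 e'].
  have [[p2 p2s p2e]|nex] := pselect (exists2 p, p \in s & le p.1 e).
    have [||||q [qs qe qmax]] := @directed_max _ (fun p q : T * T => le p.1 q.1)
      (fun p => le p.1 e) s.
    - by move=> p; exact: le_rr.
    - by move=> q p r; exact: le_tr.
    - by exists p2.
    - by move=> p q ps qs pe qe; have [pq|qp] := le_lin pe qe; [exists q|exists p].
    have [Eq Eq' _] := sE _ qs.
    have qp1 : lt q.2 p1.2.
      split; first by apply/(sle _ _ qs p1s); exact: le_tr ep1.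
      move=> E21; apply: (lt_nle ltep1); apply: le_tr qe.
      by apply/(sle _ _ p1s qs); rewrite E21.
    have [e' [Ee' ce' qe' e'p1]] := denseE Eq' Ep1' Ee qp1.
    exists e'; split=> // p ps pe; apply: le_lt_tr qe'.
    by apply/(sle _ _ ps qs); exact: qmax.
  have [e' [Ee' ce' e'p1]] := belowE Ep1' Ee.
  by exists e'; split=> // p ps pe; exfalso; apply: nex; exists p.
have above p : p \in s -> le e p.1 -> le e' p.2.
  move=> ps ep; apply: le_tr (proj1 e'p1) _.
  by apply/(sle _ _ p1s ps); exact: p1min.
have above' p : p \in s -> le e' p.2 -> le e p.1.
  move=> ps ep; have [r [rs [rp rp1 _] [_ _ rP2]]] := sglb _ _ ps p1s.
  have [re|er] := le_lin rp1 (proj1 ltep1); last exact: le_tr rp.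
  by case: (lt_nle (K _ rs re)); apply: rP2 => //; case: e'p1.
exists e'; apply: partial_iso_cons => //.
- move=> p ps; split; split.
  + by move=> pe; have [] := K _ ps pe.
  + move=> pe'; have pp1 : le p.1 p1.1.
      by apply/(sle _ _ ps p1s); apply: le_tr pe' _; case: e'p1.
    have [//|ep] := le_lin pp1 (proj1 ltep1).
    case: (lt_nle e'p1); apply: le_tr pe'.
    by apply/(sle _ _ p1s ps); exact: p1min.
  + exact: above.
  + exact: above'.
- move=> p ps; have [ep|nep] := pselect (le e p.1).
    exists (e, e'); rewrite inE eqxx; split=> //; apply: glbC; apply: glb_l => //.
    exact: above.
  have [r [rs [rp rp1 rP] [rp' rp1' rP']]] := sglb _ _ ps p1s.
  have re : le r.1 e.
    have [//|er] := le_lin rp1 (proj1 ltep1).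
    by case: nep; exact: le_tr rp.
  exists r; rewrite inE rs orbT; split=> //; split=> //.
  + by move=> x Ex xp xe; apply: rP => //; exact: le_tr ep1.
  + by have [] := K _ rs re.
  + by move=> x Ex xp xe; apply: rP' => //; apply: le_tr xe _; case: e'p1.
Qed.

(** Pigeonhole. If [r] represents the occupied cones at [pe], then [d] and [r] occupy one cone more,
    so [pe.2] also has [size r + 1] cones; they cannot all contain image points, which occupy only
    those represented by [r]. *)
Lemma free_cone s pe d : partial_iso s -> pe \in s -> E d -> lt pe.1 d ->
  (forall p x, p \in s -> E x -> le x p.1 -> le x d -> le x pe.1) ->
  exists y, [/\ E y, lt pe.2 y &
    forall p, p \in s -> lt pe.2 p.2 -> ~ same_cone pe.2 y p.2].
Proof.
move=> PIs pes Ed ed dP; have [sE sle sglb] := PIs.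
have [Ee Ee' cee'] := sE _ pes.
have ltP p q : p \in s -> q \in s -> lt p.1 q.1 <-> lt p.2 q.2.
  move=> ps qs; split=> -[l n]; split.
  - exact/(sle _ _ ps qs).
  - by move=> E2; apply: n; apply: le_as => //; apply/(sle _ _ qs ps); rewrite E2.
  - exact/(sle _ _ ps qs).
  - by move=> E2; apply: n; apply: le_as => //; apply/(sle _ _ qs ps); rewrite E2.
have coneP p q : p \in s -> q \in s ->
    same_cone pe.2 p.2 q.2 -> same_cone pe.1 p.1 q.1.
  move=> ps qs [t [Et et tp tq]].
  have [r [rs [rp rq _] [_ _ rP]]] := sglb _ _ ps qs.
  exists r.1; split=> //; first by have [] := sE _ rs.
  by apply/(ltP _ _ pes rs); apply: lt_le_tr et _; exact: rP.
(* a maximal list of pairwise inequivalent pairs above [pe] *)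
have [r [ur rs rind rmax]] : exists r : seq (T * T), [/\ uniq r,
    forall p, p \in r -> p \in s /\ lt pe.1 p.1,
    forall p q, p \in r -> q \in r -> same_cone pe.1 p.1 q.1 -> p = q &
    forall p, p \in s -> lt pe.1 p.1 ->
      exists2 q, q \in r & same_cone pe.2 p.2 q.2].
  have H : forall s' : seq (T * T), {subset s' <= s} ->
      exists r : seq (T * T), [/\ uniq r,
      forall p, p \in r -> p \in s /\ lt pe.1 p.1,
      forall p q, p \in r -> q \in r -> same_cone pe.1 p.1 q.1 -> p = q &
      forall p, p \in s' -> lt pe.1 p.1 ->
        exists2 q, q \in r & same_cone pe.2 p.2 q.2].
    elim=> [_|p s' IH sub]; first by exists [::].
    have [|r [ur rs rind rmax]] := IH.
      by move=> q qs; apply: sub; rewrite inE qs orbT.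
    have ps : p \in s by apply: sub; rewrite inE eqxx.
    have [H|H] := pselect (lt pe.1 p.1 /\
        forall q, q \in r -> ~ same_cone pe.2 p.2 q.2); last first.
      exists r; split=> // q; rewrite inE => /orP[/eqP ->|]; last exact: rmax.
      move=> ep; apply: contrapT => nex; apply: H; split=> // q' q'r pq'.
      by apply: nex; exists q'.
    case: H => ep pr.
    have self : same_cone pe.2 p.2 p.2.
      exists p.2; split=> //; first by have [] := sE _ ps.
      by apply/(ltP _ _ pes ps).
    have coneP' q q' : q \in s -> q' \in s ->
        same_cone pe.1 q.1 q'.1 -> same_cone pe.2 q.2 q'.2.
      move=> qs q's [t [Et et tp tq]].
      have [r' [r's [_ _ rP] [rp rq _]]] := sglb _ _ qs q's.
      exists r'.2; split=> //; first by have [] := sE _ r's.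
      by apply/(ltP _ _ pes r's); apply: lt_le_tr et _; exact: rP.
    exists (p :: r); split.
    - rewrite /= ur andbT; apply/negP => pr'; exact: pr pr' self.
    - by move=> q; rewrite inE => /orP[/eqP ->|/rs].
    - move=> q q'; rewrite !inE => /orP[/eqP ->|qr] /orP[/eqP ->|q'r] //.
      + by move=> /(coneP' _ _ ps (rs _ q'r).1) /pr; case.
      + by move=> /(coneP' _ _ (rs _ qr).1 ps) /same_cone_sym /pr; case.
      + exact: rind.
    - move=> q; rewrite inE => /orP[/eqP -> _|qs' eq_].
        by exists p => //; rewrite inE eqxx.
      by have [q' q'r qq'] := rmax _ qs' eq_; exists q' => //; rewrite inE q'r orbT.
  by have [r rP] := H s (fun _ => id); exists r.
have dr p : p \in s -> ~ same_cone pe.1 d p.1.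
  move=> ps [t [Et et td tp]]; apply: (lt_nle et); exact: dP tp td.
have repd : cone_reps pe.1 (d :: map fst r).
  have selfr p : p \in r -> same_cone pe.1 p.1 p.1.
    move=> pr; have [ps ep] := rs _ pr.
    by exists p.1; split=> //; have [] := sE _ ps.
  split.
  - rewrite /= map_inj_in_uniq ?ur ?andbT.
      apply/negP => /mapP[p pr dp]; apply: (dr p); first by have [] := rs _ pr.
      by rewrite dp; exact: selfr.
    move=> p q pr qr pq; apply: rind => //.
    by rewrite -pq; exact: selfr.
  - move=> x; rewrite inE => /orP[/eqP -> //|/mapP[p pr ->]].
    by have [ps ep] := rs _ pr; split=> //; have [] := sE _ ps.
  - move=> x y; rewrite !inE => /orP[/eqP ->|/mapP[p pr ->]].
      move=> /orP[/eqP -> //|/mapP[q qr ->]] /dr; case; by have [] := rs _ qr.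
    move=> /orP[/eqP ->|/mapP[q qr ->]].
      by move=> /same_cone_sym /dr; case; have [] := rs _ pr.
    by move=> pq; rewrite (rind _ _ pr qr pq).
have [r' [ur' r'E r'ind] sr'] := conesE Ee Ee' cee' repd.
apply: contrapT => nex.
have H y : exists q, y \in r' -> q \in r /\ same_cone pe.2 y q.2.
  have [yr'|nyr'] := boolP (y \in r'); last by exists (y, y).
  have [Ey ey] := r'E _ yr'.
  have [p [ps ep yp]] : exists p, [/\ p \in s, lt pe.2 p.2 & same_cone pe.2 y p.2].
    apply: contrapT => nex'; apply: nex; exists y; split=> // p ps ep yp.
    by apply: nex'; exists p.
  have [q qr pq] := rmax _ ps ((ltP _ _ pes ps).2 ep).
  by exists q => _; split=> //; exact: same_cone_trans pq.
have [c cP] := choice H.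
have : (size (map c r') <= size r)%N.
  apply: uniq_leq_size.
    rewrite map_inj_in_uniq// => y y' yr y'r cyy'.
    have [_ c1] := cP _ yr; have [_ c2] := cP _ y'r.
    apply: r'ind => //; apply: same_cone_trans c1 _.
    by rewrite cyy'; exact: same_cone_sym.
  by move=> _ /mapP[y yr ->]; have [] := cP _ yr.
by rewrite size_map sr' /= size_map ltnn.
Qed.

(** [d'] is placed between [pe.2] and a point of a free cone, where density supplies the colour of
    [d]. Image points meet [d'] only at or below [pe.2], as domain points meet [d] only at or below
    [pe.1]. *)
Lemma extend_cone s pe d : partial_iso s -> pe \in s -> E d -> lt pe.1 d ->
  (forall p x, p \in s -> E x -> le x p.1 -> le x d -> le x pe.1) ->
  exists d', partial_iso ((d, d') :: s).
Proof.
move=> PIs pes Ed ed dP; have [sE sle sglb] := PIs.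
have [Ee Ee' cee'] := sE _ pes.
have [y [Ey ey yP]] := free_cone PIs pes Ed ed dP.
have [d' [Ed' cd' ed' d'y]] := denseE Ee' Ey Ed ey.
have dP' p x : p \in s -> E x -> le x p.2 -> le x d' -> le x pe.2.
  move=> ps Ex xp xd'; have [//|ex] := le_lin xd' (proj1 ed').
  have [->|/eqP xe] := eqVneq x pe.2; first exact: le_rr.
  have ex' : lt pe.2 x by split=> //; exact: nesym.
  case: (yP p ps (lt_le_tr ex' xp)); exists x; split=> //.
  by apply: le_tr xd' _; case: d'y.
exists d'; apply: partial_iso_cons => //.
- move=> p ps; have [Ep Ep' _] := sE _ ps; split; split.
  + move=> pd; have pe_ : le p.1 pe.1 by apply: (dP p).
    by apply: le_tr (proj1 ed'); apply/(sle _ _ ps pes).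
  + move=> pd'; have pe_ : le p.2 pe.2 by apply: (dP' p).
    by apply: le_tr (proj1 ed); apply/(sle _ _ ps pes).
  + by move=> dp; case: (lt_nle ed); apply: (dP p).
  + by move=> dp; case: (lt_nle ed'); apply: (dP' p).
- move=> p ps; have [r [rs [rp re rP] [rp' re' rP']]] := sglb _ _ ps pes.
  exists r; rewrite inE rs orbT; split=> //; split=> //.
  + by apply: le_tr re _; case: ed.
  + by move=> x Ex xp xd; apply: rP => //; exact: (dP p).
  + by apply: le_tr re' _; case: ed'.
  + by move=> x Ex xp xd; apply: rP' => //; exact: (dP' p).
Qed.

(** [d] branches off the domain at the largest of its meets with domain points. That meet is
    adjoined first, to keep the domain closed under meets; [d] then opens a new cone above it. *)
Lemma extend_domain s p0 d : partial_iso s -> p0 \in s -> E d ->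
  exists s', [/\ partial_iso s', {subset s <= s'} &
    exists2 p, p \in s' & p.1 = d].
Proof.
move=> PIs p0s Ed; have [sE sle sglb] := PIs.
have [[p ps pd]|nd] := pselect (exists2 p, p \in s & p.1 = d).
  by exists s; split=> //; exists p.
have H (p : T * T) : exists m, p \in s -> E m /\ glb m p.1 d.
  have [ps|nps] := boolP (p \in s); last by exists d.
  have [Ep _ _] := sE _ ps.
  by have [m Em mP] := meetE Ep Ed; exists m.
have [m mP] := choice H.
have [||||q [qs _ qmax]] := @directed_max _ (fun p q => le (m p) (m q))
    (fun p => p \in s) s.
- by move=> p; exact: le_rr.
- by move=> q p r; exact: le_tr.
- by exists p0.
- move=> p q ps qs _ _; have [_ [_ pd _]] := mP _ ps; have [_ [_ qd _]] := mP _ qs.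
  have [pq|qp] := le_lin pd qd; [exists q|exists p]; split=> //; exact: le_rr.
have [Emq [mqq mqd _]] := mP _ qs.
have dP p x : p \in s -> E x -> le x p.1 -> le x d -> le x (m q).
  move=> ps Ex xp xd; have [_ [_ _ mpP]] := mP _ ps.
  by apply: le_tr (qmax _ ps ps); exact: mpP.
have [s1 [PIs1 ss1 [pe pes1 pem] dP1]] : exists s1, [/\ partial_iso s1,
    {subset s <= s1}, exists2 pe, pe \in s1 & pe.1 = m q &
    forall p x, p \in s1 -> E x -> le x p.1 -> le x d -> le x (m q)].
  have [[pe pes pem]|nm] := pselect (exists2 p, p \in s & p.1 = m q).
    by exists s; split=> //; exists pe.
  have [|e' PIe] := extend_below PIs qs Emq mqq.
    by move=> p ps pm; apply: nm; exists p.
  exists ((m q, e') :: s); split=> //.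
  - by move=> p ps; rewrite inE ps orbT.
  - by exists (m q, e') => //; rewrite inE eqxx.
  - by move=> p x; rewrite inE => /orP[/eqP ->|]; [|exact: dP].
have [md|/eqP md] := eqVneq (m q) d.
  by exists s1; split=> //; exists pe => //; rewrite pem.
have [||d' PId] := @extend_cone s1 pe d PIs1 pes1 Ed.
- by rewrite pem.
- by move=> p x ps1 Ex xp xd; rewrite pem; exact: (dP1 p).
exists ((d, d') :: s1); split=> //.
- by move=> p /ss1 ps; rewrite inE ps orbT.
- by exists (d, d') => //; rewrite inE eqxx.
Qed.

Lemma extend_image s p0 d : partial_iso s -> p0 \in s -> E d ->
  exists s', [/\ partial_iso s', {subset s <= s'} &
    exists2 p, p \in s' & p.2 = d].
Proof.
move=> PIs p0s Ed.
have [|s' [PIs' ss' [p ps' pd]]] :=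
  @extend_domain _ (p0.2, p0.1) d (partial_iso_swap PIs) _ Ed.
  by apply/mapP; exists p0.
exists [seq (p.2, p.1) | p <- s']; split.
- exact: partial_iso_swap.
- move=> [x y] xys; apply/mapP; exists (y, x) => //; apply: ss'.
  by apply/mapP; exists (x, y).
- by exists (p.2, p.1) => //; apply/mapP; exists p.
Qed.

Lemma back_and_forth (enum : nat -> T) a b :
  (forall e, E e -> exists n, enum n = e) -> E a -> E b -> col a = col b ->
  exists phi psi : T -> T,
    [/\ forall e, E e -> [/\ E (phi e), E (psi e), psi (phi e) = e & phi (psi e) = e],
        forall e e', E e -> E e' -> (le e e' <-> le (phi e) (phi e')) &
        phi a = b].
Proof.
move=> enumP Ea Eb cab.
have H n : exists F : seq (T * T) -> seq (T * T), forall s,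
    partial_iso s -> (a, b) \in s -> [/\ partial_iso (F s), {subset s <= F s} &
      E (enum n) -> (exists2 p, p \in F s & p.1 = enum n) /\
        exists2 p, p \in F s & p.2 = enum n].
  have /choice[F FP] : forall s, exists s', partial_iso s -> (a, b) \in s ->
      [/\ partial_iso s', {subset s <= s'} &
      E (enum n) -> (exists2 p, p \in s' & p.1 = enum n) /\
        exists2 p, p \in s' & p.2 = enum n].
    move=> s; have [PIs|nPIs] := pselect (partial_iso s); last by exists s.
    have [abs|nabs] := boolP ((a, b) \in s); last by exists s.
    have [En|nEn] := pselect (E (enum n)); last by exists s => _ _; split.
    have [s1 [PI1 ss1 [p ps1 pn]]] := extend_domain PIs abs En.
    have [s2 [PI2 ss2 q2]] := extend_image PI1 (ss1 _ abs) En.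
    exists s2 => _ _; split=> //; first by move=> x /ss1 /ss2.
    by move=> _; split; [exists p; [exact: (ss2 _ ps1)|]|].
  by exists F.
have [F FP] := choice H.
pose s := fix s n := if n is n'.+1 then F n' (s n') else [:: (a, b)].
have sP n : partial_iso (s n) /\ (a, b) \in s n.
  elim: n => [|n [IH1 IH2]].
    split; last by rewrite inE.
    have ab p : p \in [:: (a, b)] -> p = (a, b) by rewrite inE => /eqP.
    split.
    - by move=> p /ab ->.
    - by move=> p q /ab -> /ab ->; split=> _; exact: le_rr.
    - move=> p q /ab -> /ab ->; exists (a, b); rewrite inE eqxx.
      by split=> //; exact: glb_l.
  by have [PI sub _] := FP n (s n) IH1 IH2; split=> //; exact: sub.
have smono m n : (m <= n)%N -> {subset s m <= s n}.
  move=> /subnK <-; elim: (n - m)%N => [//|k IH] x /IH xs.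
  by have [PI ab] := sP (k + m)%N; have [_ sub _] := FP (k + m)%N _ PI ab; exact: sub.
pose G p := exists n, p \in s n.
have GE p : G p -> E p.1 /\ E p.2.
  by move=> [n pn]; have [[/(_ _ pn)[]]] := sP n.
have Gle p q : G p -> G q -> (le p.1 q.1 <-> le p.2 q.2).
  move=> [m pm] [n qn]; have [[_ sle _] _] := sP (maxn m n).
  by apply: sle; [exact: smono (leq_maxl _ _) _ pm|exact: smono (leq_maxr _ _) _ qn].
have Gdom e : E e -> (exists2 p, G p & p.1 = e) /\ (exists2 p, G p & p.2 = e).
  move=> Ee; have [n en] := enumP e Ee; rewrite -en in Ee *.
  have [PI ab] := sP n; have [_ _ /(_ Ee)[[p pn pe] [q qn qe]]] := FP n _ PI ab.
  by split; [exists p|exists q] => //; exists n.+1.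
have /choice[phi phiP] : forall e, exists e', E e -> G (e, e').
  move=> e; have [Ee|nEe] := pselect (E e); last by exists e.
  by have [[[x y] Gp /= <-] _] := Gdom e Ee; exists y.
have /choice[psi psiP] : forall e, exists e', E e -> G (e', e).
  move=> e; have [Ee|nEe] := pselect (E e); last by exists e.
  by have [_ [[x y] Gp /= <-]] := Gdom e Ee; exists x.
have inj1 x x' y : G (x, y) -> G (x', y) -> x = x'.
  move=> G1 G2; apply: le_as.
    by apply/(Gle _ _ G1 G2); exact: le_rr.
  by apply/(Gle _ _ G2 G1); exact: le_rr.
have inj2 x y y' : G (x, y) -> G (x, y') -> y = y'.
  move=> G1 G2; apply: le_as.
    by apply/(Gle _ _ G1 G2); exact: le_rr.
  by apply/(Gle _ _ G2 G1); exact: le_rr.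
exists phi, psi; split.
- move=> e Ee; have Gphi := phiP _ Ee; have Gpsi := psiP _ Ee.
  have [_ E1] := GE _ Gphi; have [E2 _] := GE _ Gpsi.
  split=> //; first exact: inj1 (psiP _ E1) Gphi.
  exact: inj2 (phiP _ E2) Gpsi.
- by move=> e e' Ee Ee'; exact: Gle (phiP _ Ee) (phiP _ Ee').
- by apply: inj2 (phiP _ Ea) _; exists 0%N; rewrite inE.
Qed.

End BackAndForth.

(** * Ramification points *)

Section Order.
Variable X : topologicalType.

Definition order_ge n (p : order_value) := if p is Some k then (n <= k)%N else true.

(** Exhibiting [n] components avoids a case distinction on finiteness; [order_ge 3] is [at_least3]
    by conversion. *)
Lemma order_geP n (x : X) : order_ge n (point_order x) <->
  exists l : seq (set X), [/\ uniq l, size l = n &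
    forall S, S \in l -> components (~` [set x]) S].
Proof.
rewrite /point_order; case: pselect => [fin|inf] /=; split.
- move=> nk; exists (take n (enum_fset (fset_set (components (~` [set x]))))).
  split; first by rewrite take_uniq ?fset_uniq.
    by rewrite size_take_min (minn_idPl nk).
  by move=> S /mem_take SK; apply: set_mem; rewrite -(in_fset_set fin).
- move=> [l [ul <- lS]]; apply: uniq_leq_size ul _ => S Sl.
  by rewrite in_fset_set// inE; exact: lS.
- move=> _; have [B BC nB] := infinite_set_fset n inf.
  exists (take n (enum_fset B)); split; first by rewrite take_uniq ?fset_uniq.
    by rewrite size_take_min (minn_idPl nB).
  by move=> S /mem_take SK; exact: BC.
- by [].
Qed.

End Order.

(** * Countability and density of the ramification points *)

Section Wazewski.
Variables (R : realType) (P : set order_value) (X : topologicalType).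
Hypothesis wd : wazewski_dendrite R P X.
Implicit Types (x y z a b e m : X).

Let dend : dendrite R X. Proof. by case: wd. Qed.
Let cX : compact [set: X]. Proof. by case: dend. Qed.
Let cT : connected [set: X]. Proof. by case: dend. Qed.
Let lc : locally_connected X. Proof. by case: dend. Qed.
Let hX : hausdorff_space X := dendrite_hausdorff dend.

Notation ram := (@ramification_point X).

Lemma ram_separates m x y w : x <> m -> y <> m -> w <> m ->
  ~ cc m x y -> ~ cc m x w -> ~ cc m y w -> ram m.
Proof.
move=> xm ym wm xy xw yw; apply/(order_geP 3).
have neq a b : b <> m -> ~ cc m a b -> (cc m a == cc m b) = false.
  by move=> bm nab; apply/eqP => E; apply: nab; rewrite E; exact: cc_refl.
exists [:: cc m x; cc m y; cc m w]; split=> //.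
  by rewrite /= !inE !neq.
by move=> S; rewrite !inE => /or3P[] /eqP ->; [exists x|exists y|exists w].
Qed.

Lemma ram_triple m : ram m -> exists x y w, [/\ x <> m, y <> m & w <> m] /\
  [/\ ~ cc m x y, ~ cc m x w & ~ cc m y w].
Proof.
move=> /(order_geP 3)[l [ul sl lS]].
case: l ul sl lS => [|S1 [|S2 [|S3 [|? ?]]]] //= ul _ lS.
have [|x xm E1] := lS S1; first by rewrite !inE eqxx.
have [|y ym E2] := lS S2; first by rewrite !inE eqxx orbT.
have [|w wm E3] := lS S3; first by rewrite !inE eqxx !orbT.
exists x, y, w; split=> //; move: ul; rewrite -E1 -E2 -E3 !inE /cc.
move=> /and3P[/norP[/eqP n1 /eqP n2] /eqP n3 _].
by split=> H; [apply: n1|apply: n2|apply: n3]; exact: same_connected_component.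
Qed.

Lemma finite_net (d : X -> X -> R) (eps : R) : is_metric d -> 0 < eps ->
  exists s : seq X, forall x, exists2 y, y \in s & d x y < eps.
Proof.
move=> dm e0; apply: contrapT => nex.
pose B (s : seq X) := [set x | forall y, y \in s -> eps <= d x y].
have GF : ProperFilter (filter_from [set: seq X] B).
  apply: filter_from_proper.
    apply: filter_from_filter; first by exists [::].
    move=> s t _ _; exists (s ++ t) => // x xst.
    by split=> y ys; apply: xst; rewrite mem_cat ys ?orbT.
  move=> s _; apply: contrapT => Bs; apply: nex; exists s => x.
  apply: contrapT => nx; apply: Bs; exists x => y ys.
  by rewrite leNgt; apply/negP => xy; apply: nx; exists y.
have [|p [_ cl]] := cX GF; first by exists [::].
have [||x [xp px]] := cl (B [:: p]) [set y | d p y < eps].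
- by exists [:: p].
- exact: nbhs_dist.
by have := xp p; rewrite inE eqxx leNgt (distC dm) => /(_ isT); rewrite px.
Qed.

Lemma dense_sequence : exists q : nat -> X,
  forall O : set X, open O -> O !=set0 -> exists n, O (q n).
Proof.
have [d dm] : exists d : X -> X -> R, is_metric d by case: dend.
have [x0 _] : exists x0 : X, True by case: wd => _ [x0 [y0 _]] _ _; exists x0.
have /choice[net netP] n := finite_net dm (rad_gt0 R n).
exists (fun k => if @choice.unpickle (nat * nat)%type k is Some (n, i)
  then nth x0 (net n) i else x0) => O oO [x Ox].
have [e e0 eO] := nbhs_distE dm (open_nbhs_nbhs (conj oO Ox)).
have [n ne] := rad_lt e0; have [y yn xy] := netP n x.
exists (choice.pickle (n, index y (net n))).
by rewrite choice.pickleK nth_index//; apply: eO; exact: lt_trans xy ne.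
Qed.

(* Together with a dense sequence, this makes the set of ramification points
   countable. *)
Lemma center_unique m m' x y w : x <> m -> y <> m -> w <> m ->
  ~ cc m x y -> ~ cc m x w -> ~ cc m y w ->
  ~ cc m' x y -> ~ cc m' x w -> ~ cc m' y w -> m = m'.
Proof.
move=> xm ym wm xy xw yw xy' xw' yw'; apply: contrapT => mm'.
have H a : a <> m -> ~ cc m a m' -> cc m' m a.
  move=> am nam; apply: (cc_max (@cc_closure _ cT lc hX _ _ am)); first by right.
    by case=> // /esym.
  by left; exact: cc_refl.
(* Of two points separated by [m'], one lies in the component at [m] that contains [m']. Used twice,
   this puts two of [x], [y], [w] there, although [m] separates them. *)
have key a b : a <> m -> b <> m -> ~ cc m' a b -> cc m a m' \/ cc m b m'.
  move=> am bm nab; have [|na] := pselect (cc m a m'); first by left.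
  have [|nb] := pselect (cc m b m'); first by right.
  exfalso; apply: nab; apply: cc_trans (H _ bm nb); apply: cc_sym; exact: H.
have tr a b : cc m a m' -> cc m b m' -> cc m a b.
  by move=> am bm; apply: cc_trans am _; exact: cc_sym.
have [xm'|ym'] := key x y xm ym xy'.
  by have [ym'|wm'] := key y w ym wm yw'; [apply: xy|apply: xw]; exact: tr.
by have [xm'|wm'] := key x w xm wm xw'; [apply: xy|apply: yw]; exact: tr.
Qed.

(** Components at [e] are open, so three of them contain terms of the dense sequence, and this
    triple of indices determines [e]. *)
Lemma ram_enum : exists enum : nat -> X,
  forall e, ram e -> exists n, enum n = e.
Proof.
have [q qP] := dense_sequence.
pose sep m (t : nat * nat * nat) := let x := q t.1.1 in let y := q t.1.2 in
  let w := q t.2 in [/\ x <> m, y <> m & w <> m] /\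
    [/\ ~ cc m x y, ~ cc m x w & ~ cc m y w].
have /choice[enum enumP] : forall n, exists m,
    forall t, @choice.unpickle (nat * nat * nat)%type n = Some t ->
    forall m', sep m' t -> m = m'.
  move=> n; case: (choice.unpickle n) => [t|]; last by exists (q 0%N).
  have [[m sm]|nex] := pselect (exists m, sep m t); last first.
    by exists (q 0%N) => _ [<-] m' sm'; exfalso; apply: nex; exists m'.
  exists m => _ [<-] m' [_ [a b c]]; have [[? ? ?] [? ? ?]] := sm.
  exact: (center_unique _ _ _ _ _ _ a b c).
exists enum => e /ram_triple[x [y [w [[xe ye we] [xy xw yw]]]]].
have near a : a <> e -> exists n, cc e a (q n).
  by move=> ae; apply: qP; [exact: cc_open|exists a; exact: cc_refl].
have [[i xi] [j yj] [k wk]] := And3 (near _ xe) (near _ ye) (near _ we).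
have ncc a b n n' : cc e a (q n) -> cc e b (q n') -> ~ cc e a b ->
    ~ cc e (q n) (q n').
  move=> an bn' nab nn'; apply: nab; apply: cc_trans an _.
  by apply: cc_trans nn' _; exact: cc_sym.
exists (choice.pickle (i, j, k)); apply: (enumP _ (i, j, k)).
  exact: choice.pickleK.
split; split; rewrite /=.
- exact: cc_neq xi.
- exact: cc_neq yj.
- exact: cc_neq wk.
- exact: ncc xi yj xy.
- exact: ncc xi wk xw.
- exact: ncc yj wk yw.
Qed.

Lemma dense_ram e0 z a b : ram e0 -> tle z a b -> a <> b ->
  exists e, [/\ ram e /\ point_order e = point_order e0, e <> a, e <> b,
    tle z a e & tle z e b].
Proof.
move=> re0 ab nab; have [_ _ rP dP] := wd.
by have [e] := dense_lt dend (dP _ (rP _ re0)) ab nab; exists e.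
Qed.

End Wazewski.

(** * Homeomorphisms supported in a branch *)

Section Branch.
Variables (R : realType) (P : set order_value) (X : topologicalType).
Hypothesis wd : wazewski_dendrite R P X.
Variables z x0 : X.
Implicit Types (x y a b e m : X).

Let dend : dendrite R X. Proof. by case: wd. Qed.
Let cT : connected [set: X]. Proof. by case: dend. Qed.
Let lc : locally_connected X. Proof. by case: dend. Qed.
Let hX : hausdorff_space X := dendrite_hausdorff dend.

Notation ram := (@ramification_point X).
Notation U := (cc z x0).
Notation "a ≼ b" := (tle z a b) (at level 70).

Definition branch_ram : set X := [set e | ram e /\ U e].
Notation E := branch_ram.

Let anti a b : a ≼ b -> b ≼ a -> a = b. Proof. exact: tle_antisym. Qed.
Let trans b a e : a ≼ b -> b ≼ e -> a ≼ e. Proof. exact: tle_trans. Qed.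
Let lin a b e : a ≼ e -> b ≼ e -> a ≼ b \/ b ≼ a. Proof. exact: tle_total. Qed.

Lemma branch_cc x y : U x -> cc z x y -> U y. Proof. exact: cc_trans. Qed.

Lemma branch_up e x : U e -> e ≼ x -> U x.
Proof.
move=> Ue ex; apply: contrapT => nUx.
have [xz|/eqP xz] := eqVneq x z.
  by apply: (cc_neq Ue); apply: tle_root_eq; rewrite -{2}xz.
apply: ex; apply: (cc_max (@cc_closure _ cT lc hX _ _ xz)); first by right.
- case=> [xe|ez]; last exact: (cc_neq Ue).
  by apply: nUx; apply: branch_cc Ue _; exact: cc_sym.
- by left; exact: cc_refl.
Qed.

Lemma branch_down e x : U x -> e ≼ x -> e <> z -> U e.
Proof.
move=> Ux ex ez; apply: contrapT => nUe; apply: ex.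
have xz := cc_neq Ux.
apply: (cc_max (@cc_closure _ cT lc hX _ _ xz)); first by right.
- by case=> [xe|//]; apply: nUe; exact: branch_cc Ux xe.
- by left; exact: cc_refl.
Qed.

(** The meet [m] separates [z], [a] and [b] pairwise, so it is a ramification point. It is not [z],
    since [a] and [b] share a component at [z]. *)
Lemma branch_fork a b : U a -> U b -> ~ a ≼ b -> ~ b ≼ a ->
  exists m, [/\ E m, m ≼ a, m ≼ b, forall e, e ≼ a -> e ≼ b -> e ≼ m &
    ~ cc m a b].
Proof.
move=> Ua Ub nab nba; have [m [ma mb mP]] := meet_ex dend z a b.
have sab := meet_separates dend nab nba ma mb mP.
have mz : m <> z.
  move=> mz; apply: sab; rewrite mz; apply: cc_trans Ub.
  exact: cc_sym.
exists m; split=> //; split; last exact: branch_down ma mz.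
apply: (@ram_separates _ m z a b) => //.
- exact: nesym.
- by move=> am; apply: nab; rewrite am.
- by move=> bm; apply: nba; rewrite bm.
Qed.

Lemma branch_dense c a b : E c -> a ≼ b -> a <> b -> U b ->
  exists e, [/\ E e, point_order e = point_order c, a ≼ e /\ a <> e &
    e ≼ b /\ e <> b].
Proof.
move=> [rc _] ab nab Ub.
have [e [[re ce] ea eb ae eb']] := dense_ram wd rc ab nab.
exists e; split=> //; last by split=> //; exact: nesym.
split=> //; apply: branch_down eb' _ => // ez.
by apply: ea; rewrite ez; apply/esym/tle_root_eq; rewrite -[X in _ ≼ X]ez.
Qed.

Let glbE := glb (tle z) E.

Lemma branch_meet a b : E a -> E b -> exists2 m, E m & glbE m a b.
Proof.
move=> Ea Eb; have [ab|nab] := pselect (a ≼ b).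
  by exists a => //; split=> //; exact: tle_refl.
have [ba|nba] := pselect (b ≼ a).
  by exists b => //; split=> //; exact: tle_refl.
have [m [Em ma mb mP _]] := branch_fork Ea.2 Eb.2 nab nba.
by exists m => //; split=> // e _; exact: mP.
Qed.

(** Identifies the cones of the back-and-forth with components. If [x] and [y] are incomparable,
    their meet is the witness: it separates them, so it differs from [a]. *)
Lemma branch_same_cone a x y : U x -> U y ->
  a ≼ x /\ a <> x -> a ≼ y /\ a <> y -> (exists c, E c) ->
  same_cone (tle z) E a x y <-> cc a x y.
Proof.
move=> Ux Uy [ax nax] [ay nay] [c Ec]; split.
  move=> [t [Et [at_ nat_] tx ty]].
  exact: (tle_cc cT lc hX at_ (nesym nat_) tx ty).
move=> xy.
have low u v : U u -> a ≼ u -> a <> u -> u ≼ v -> same_cone (tle z) E a u v.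
  move=> Uu au nau uv; have [t [Et _ at_ [tu _]]] := branch_dense Ec au nau Uu.
  by exists t; split=> //; exact: trans uv.
have [xley|nxy] := pselect (x ≼ y); first exact: low.
have [ylex|nyx] := pselect (y ≼ x); first exact/same_cone_sym/low.
have [m [Em mx my mP nm]] := branch_fork Ux Uy nxy nyx.
exists m; split=> //; split; first exact: mP.
by move=> am; apply: nm; rewrite -am.
Qed.

Lemma branch_cones a b : E a -> E b -> point_order a = point_order b ->
  forall r, cone_reps (tle z) E a r ->
    exists2 r', cone_reps (tle z) E b r' & size r' = size r.
Proof.
move=> Ea Eb ab r [ur rE rind].
have [l [ul sl lS]] : exists l : seq (set X), [/\ uniq l, size l = (size r).+1 &
    forall S, S \in l -> components (~` [set b]) S].
  apply/order_geP; rewrite -ab; apply/order_geP.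
  (* The order also counts the component of the root, which is not a cone above [a]; hence the extra
     unit. *)
  exists (cc a z :: map (cc a) r); split; last 1 first.
  - move=> S; rewrite inE => /orP[/eqP ->|/mapP[x xr ->]].
      by exists z => // za; exact: (cc_neq Ea.2 (esym za)).
    by exists x => // xa; have [_ [_ nax]] := rE _ xr; apply: nax.
  - rewrite /= map_inj_in_uniq ?ur ?andbT.
      apply/negP => /mapP[x xr zx]; have [_ [ax nax]] := rE _ xr.
      by apply: ax; rewrite zx; apply: cc_refl; exact: nesym.
    move=> x y xr yr xy; have [Ex ax] := rE _ xr; have [Ey ay] := rE _ yr.
    apply: rind => //; apply/(branch_same_cone Ex.2 Ey.2 ax ay); first by exists x.
    by rewrite xy; apply: cc_refl; apply: nesym; case: ay.
  - by rewrite /= size_map.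
(* At most one member of [l] is the component of the root; without it at least [size r] cones above
   [b] remain. *)
pose l' := take (size r) (rem (cc b z) l).
have ul' : uniq l' by rewrite take_uniq// rem_uniq.
have sl' : size l' = size r.
  rewrite size_take_min; apply/minn_idPl.
  have [zl|zl] := boolP (cc b z \in l); first by rewrite size_rem// sl.
  by rewrite rem_id// sl.
have /choice[rep repP] : forall S, exists e, S \in l' ->
    [/\ E e, b ≼ e, b <> e & cc b e = S].
  move=> S; have [Sl'|nSl'] := boolP (S \in l'); last by exists b.
  have := mem_take Sl'; rewrite (mem_rem_uniq _ ul) inE => /andP[/eqP Sz Sl].
  have [y yb yS] := lS _ Sl.
  have by_ : b ≼ y.
    by move=> bzy; apply: Sz; rewrite -yS; apply/esym/same_connected_component.
  have Uy := branch_up Eb.2 by_.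
  have [e [Ee _ [be nbe] [ey _]]] := branch_dense Eb by_ (nesym yb) Uy.
  exists e => _; split=> //; rewrite -yS; apply: same_connected_component.
  by apply: (tle_cc cT lc hX be (nesym nbe) _ ey); exact: tle_refl.
exists (map rep l'); last by rewrite size_map.
split.
- rewrite map_inj_in_uniq// => S S' Sl S'l SS'.
  by have [_ _ _ <-] := repP _ Sl; have [_ _ _ <-] := repP _ S'l; rewrite SS'.
- by move=> _ /mapP[S Sl ->]; have [? ? ? _] := repP _ Sl.
- move=> _ _ /mapP[S Sl ->] /mapP[S' S'l ->] SS'.
  have [E1 b1 n1 S1] := repP _ Sl; have [E2 b2 n2 S2] := repP _ S'l.
  congr rep; rewrite -S1 -S2; apply: same_connected_component.
  by apply/(branch_same_cone E1.2 E2.2) => //; exists (rep S).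
Qed.

Definition branch_iso (phi psi : X -> X) :=
  (forall e, E e -> [/\ E (phi e), E (psi e), psi (phi e) = e & phi (psi e) = e]) /\
  forall e e', E e -> E e' -> (e ≼ e' <-> phi e ≼ phi e').

Lemma branch_iso_ex a b : E a -> E b -> point_order a = point_order b ->
  exists phi psi, branch_iso phi psi /\ phi a = b.
Proof.
move=> Ea Eb ab; have [enum enumP] := ram_enum wd.
have dense a' b' c : E a' -> E b' -> E c -> a' ≼ b' /\ a' <> b' ->
    exists e, [/\ E e, point_order e = point_order c, a' ≼ e /\ a' <> e &
      e ≼ b' /\ e <> b'].
  by move=> _ [_ Ub] Ec [ab' nab]; exact: branch_dense.
have below b' c : E b' -> E c -> exists e,
    [/\ E e, point_order e = point_order c & e ≼ b' /\ e <> b'].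
  move=> [_ Ub] Ec; have zb : z <> b' by apply: nesym; exact: cc_neq Ub.
  by have [e [Ee ce _ eb]] := branch_dense Ec (@tle_root X z b') zb Ub; exists e.
have [|phi [psi [H1 H2 H3]]] := @back_and_forth X order_value (tle z) E
  (@point_order X) (@tle_refl X z) trans anti lin branch_meet
  dense below branch_cones enum a b _ Ea Eb ab.
  by move=> e [re _]; exact: enumP.
by exists phi, psi.
Qed.

Lemma branch_iso_sym phi psi : branch_iso phi psi -> branch_iso psi phi.
Proof.
move=> [H1 H2]; split=> [e /H1[]//|e e' Ee Ee'].
have [_ Ep _ pe] := H1 _ Ee; have [_ Ep' _ pe'] := H1 _ Ee'.
by rewrite -{1}pe -{1}pe'; apply: iff_sym; exact: H2.
Qed.

(* [f] fixes the complement of the branch, and on the branch it acts on the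
   traces [{e in E | e <= x}] as [phi] does. *)
Definition extends (phi f : X -> X) := [/\ forall x, ~ U x -> f x = x,
  forall x, U x -> U (f x) & forall e x, E e -> (e ≼ x <-> phi e ≼ f x)].

(** If [u] were not below [v], density would give a point of [E] strictly between their meet and
    [u], hence below [u] but not below [v]. *)
Lemma trace_inj x y : U x -> U y -> (exists c, E c) ->
  (forall e, E e -> (e ≼ x <-> e ≼ y)) -> x = y.
Proof.
move=> + + [c Ec]; suff H u v : U u -> (forall e, E e -> e ≼ u -> e ≼ v) -> u ≼ v.
  by move=> Ux Uy xy; apply: anti; apply: H => // e Ee /(xy _ Ee).
move=> Uu uv; have [m [mu mv mP]] := meet_ex dend z u v.
have [mu'|/eqP mu'] := eqVneq m u; first by rewrite -mu'.
have [t [Et _ [mt nmt] [tu _]]] := branch_dense Ec mu mu' Uu.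
by exfalso; apply: nmt; apply: anti mt _; apply: mP => //; exact: uv.
Qed.

(** [f x] is the supremum of the images of the trace of [x]; the difficulty is that no further image
    falls below this supremum. *)
Lemma extends_ex phi psi : branch_iso phi psi -> (exists c, E c) ->
  exists f, extends phi f.
Proof.
move=> [H1 H2] [c Ec].
have /choice[f fP] : forall x, exists y, (~ U x -> y = x) /\
    (U x -> U y /\ forall e, E e -> (e ≼ x <-> phi e ≼ y)).
  move=> x; have [Ux|nUx] := pselect (U x); last by exists x.
  pose C := [set phi e | e in [set e | E e /\ e ≼ x]].
  have [|s [sub sleast]] := @sup_ex _ _ dend z C.
    move=> _ _ [e [Ee ex] <-] [e' [Ee' e'x] <-].
    by have [/(H2 _ _ Ee Ee')|/(H2 _ _ Ee' Ee)] := lin ex e'x; [left|right].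
  have subC e : E e -> e ≼ x -> phi e ≼ s by move=> Ee ex; apply: sub; exists e.
  exists s; split=> // _.
  have zx : z <> x by apply: nesym; exact: cc_neq Ux.
  have [t [Et _ _ [tx _]]] := branch_dense Ec (@tle_root X z x) zx Ux.
  have [[_ Ut] _ _ _] := H1 _ Et.
  split; first exact: branch_up Ut (subC _ Et tx).
  move=> e Ee; split=> [|es]; first exact: subC.
  (* If [phi e] is below [s] but [e] is not below [x], the whole trace lies below [e], so
     [s = phi e] and [x] is strictly below [e]. For a point [t'] of [E] between them, [phi t'] is an
     upper bound smaller than [s]. *)
  apply: contrapT => nex.
  have below t' : E t' -> t' ≼ x -> t' ≼ e.
    move=> Et' t'x; have := lin es (subC _ Et' t'x).
    case=> [/(H2 _ _ Ee Et') et'|/(H2 _ _ Et' Ee)//].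
    by exfalso; apply: nex; exact: trans t'x.
  have se : s = phi e.
    apply: anti es; apply: sleast => _ [t' [Et' t'x] <-].
    by apply/(H2 _ _ Et' Ee); exact: below.
  have xe : x ≼ e.
    have [m [mx me mP]] := meet_ex dend z x e.
    have [mx'|/eqP mx'] := eqVneq m x; first by rewrite -mx'.
    have [t' [Et' _ [mt' nmt'] [t'x _]]] := branch_dense Ec mx mx' Ux.
    by exfalso; apply: nmt'; apply: anti mt' _; apply: mP => //; exact: below.
  have nxe : x <> e by move=> xe'; apply: nex; rewrite xe'; exact: tle_refl.
  have [t' [Et' _ [xt' _] [t'e nt'e]]] := branch_dense Ec xe nxe Ee.2.
  apply: nt'e; apply: anti t'e _; apply/(H2 _ _ Ee Et'); rewrite -se.
  apply: sleast => _ [t'' [Et'' t''x] <-]; apply/(H2 _ _ Et'' Et').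
  exact: trans xt'.
exists f; split.
- by move=> x; exact: (fP x).1.
- by move=> x Ux; have [] := (fP x).2 Ux.
- move=> e x Ee; have [Ux|nUx] := pselect (U x); first exact: ((fP x).2 Ux).2.
  rewrite ((fP x).1 nUx); split=> H; exfalso; apply: nUx.
    exact: branch_up Ee.2 H.
  by have [[_ Up] _ _ _] := H1 _ Ee; exact: branch_up Up H.
Qed.

Lemma extends_cancel phi psi f g : branch_iso phi psi -> (exists c, E c) ->
  extends phi f -> extends psi g -> cancel f g.
Proof.
move=> [H1 H2] Eex [f1 f2 f3] [g1 g2 g3] x.
have [Ux|nUx] := pselect (U x); last by rewrite (f1 _ nUx) (g1 _ nUx).
apply: trace_inj => //; first exact/g2/f2.
move=> e Ee; have [Ep _ qp _] := H1 _ Ee.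
have := g3 _ (f x) Ep; rewrite qp => gfx.
by apply: iff_sym; exact: iff_trans (f3 _ _ Ee) gfx.
Qed.

Lemma extends_eq phi psi f e : branch_iso phi psi -> extends phi f -> E e ->
  f e = phi e.
Proof.
move=> [H1 H2] [f1 f2 f3] Ee; have [Ep _ _ _] := H1 _ Ee.
apply: trace_inj; [exact/f2/Ee.2|exact: Ep.2|by exists e|].
move=> e' Ee'; have [_ Eq _ <-] := H1 _ Ee'.
by apply: iff_trans (H2 _ _ Eq Ee); apply: iff_sym; exact: f3.
Qed.

(** Preservation of components, obtained before continuity. Outside the branch, [f] moves points
    only within the connected set [U], which misses [t]; for [t] in [E], cones above [t] go to cones
    and the rest stays with [z]. *)
Lemma extends_cc phi psi f t x y : branch_iso phi psi -> extends phi f ->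
  E t \/ ~ U t -> cc t x y -> cc (f t) (f x) (f y).
Proof.
move=> I ext Et xy; have [H1 H2] := I; have [f1 f2 f3] := ext.
have yt := cc_neq xy; have xt := cc_neq (cc_sym xy).
case: Et => [Et|nUt]; last first.
  have same u : u <> t -> cc t u (f u).
    move=> ut; have [Uu|nUu] := pselect (U u); last by rewrite f1//; exact: cc_refl.
    by apply: (@cc_max _ t u U) => //; [exact: component_connected|exact: f2].
  rewrite (f1 _ nUt); apply: cc_trans (same _ yt).
  by apply: cc_trans xy; apply: cc_sym; exact: same.
rewrite (extends_eq I ext Et).
have [[rp Up] _ _ _] := H1 _ Et.
have [tx|ntx] := pselect (t ≼ x); last first.
  have nty : ~ t ≼ y by move=> ty; apply: ntx; apply: cc_tle ty; exact: cc_sym.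
  have nfx : ~ phi t ≼ f x by move=> /(f3 _ _ Et).
  have nfy : ~ phi t ≼ f y by move=> /(f3 _ _ Et).
  by apply: cc_trans (contrapT nfy); apply: cc_sym; exact: contrapT nfx.
have ty : t ≼ y by exact: cc_tle xy tx.
have Ux := branch_up Et.2 tx; have Uy := branch_up Et.2 ty.
have [|e [Ee [te nte] ex ey]] := (branch_same_cone Ux Uy (conj tx (nesym xt))
    (conj ty (nesym yt)) _).2 xy; first by exists t.
have pte : phi t <> phi e.
  move=> E1; apply: nte; have [_ _ <- _] := H1 _ Et.
  by have [_ _ <- _] := H1 _ Ee; rewrite E1.
apply: (tle_cc cT lc hX _ (nesym pte)).
- exact/(H2 _ _ Et Ee).
- exact/(f3 _ _ Ee).
- exact/(f3 _ _ Ee).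
Qed.

(** A closed graph argument. If [v' <> f x], a ramification point [t] separates [x] from [g v']; the
    components of [x] at [t] and of [v'] at [f t] are neighbourhoods that [f] does not connect.
    Compactness of the complement of [V'] makes one neighbourhood of [x] work for all [v']. *)
Lemma extends_continuous phi psi f g : branch_iso phi psi -> (exists c, E c) ->
  extends phi f -> extends psi g -> continuous f.
Proof.
move=> I [c Ec] extf extg x V; rewrite nbhsE => -[V' [oV' V'fx] V'V].
have I' := branch_iso_sym I.
have fg := extends_cancel I (ex_intro _ c Ec) extf extg.
have gf := extends_cancel I' (ex_intro _ c Ec) extg extf.
have [f1 f2 f3] := extf; have [H1 H2] := I.
have cK : compact (~` V') by apply: (sub_compact dend); exact: open_closedC.
suff : \forall x' \near x, ~` V' `<=` [set v' | f x' <> v'].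
  by apply: filterS => x' H; apply: V'V; apply: contrapT => nV; exact: (H _ nV).
apply: ((compact_near_coveringP _).1 cK X (nbhs x) (fun x' v' => f x' <> v')).
move=> v' nVv'.
have xv : x <> g v' by move=> xv; apply: nVv'; rewrite -(gf v') -xv.
have [t [[[rt _] tx tv _ tsep]]] := dense_ram wd Ec.1 (@tle_root X x (g v')) xv.
have Et : E t \/ ~ U t by have [?|?] := pselect (U t); [left|right].
have Eft : E (f t) \/ ~ U (f t).
  case: Et => [Et|nUt]; last by right; rewrite f1.
  by left; rewrite (extends_eq I extf Et); have [] := H1 _ Et.
have vft : v' <> f t by move=> vt; apply: tv; rewrite vt fg.
exists (cc (f t) v', cc t x) => /=.
  split; apply: open_nbhs_nbhs; split; try exact: cc_open.
    exact: cc_refl.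
  by apply: cc_refl; exact: nesym.
move=> [v'' x'] /= [vv'' xx'] fxv; rewrite -fxv in vv''.
have := extends_cc I' extg Eft vv''; rewrite !fg => vx'.
apply: tsep; apply: cc_trans xx' _; exact: cc_sym.
Qed.

End Branch.

(** * Infinitely many disjoint branches *)

Section DisjointBranches.
Variables (R : realType) (P : set order_value) (X : topologicalType).
Hypothesis P0 : P !=set0.
Hypothesis wd : wazewski_dendrite R P X.

Let dend : dendrite R X. Proof. by case: wd. Qed.
Let cT : connected [set: X]. Proof. by case: dend. Qed.
Let lc : locally_connected X. Proof. by case: dend. Qed.
Let hX : hausdorff_space X := dendrite_hausdorff dend.

Lemma ram_exists (x y : X) : x <> y -> exists e : X, ramification_point e.
Proof.
move=> xy; have [p Pp] := P0; have [_ _ _ dP] := wd.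
by have [e [[re _] _ _ _]] := dense_between dend (dP _ Pp) xy; exists e.
Qed.

Lemma branch_homeo (z x0 : X) : x0 <> z ->
  exists h : X -> X, [/\ Homeo h, h <> id & forall x, ~ cc z x0 x -> h x = x].
Proof.
move=> x0z; have [e0 re0] := ram_exists x0z.
have Ux0 : cc z x0 x0 by exact: cc_refl.
have [a [[ra _] az ax za ax0]] := dense_ram wd re0 (@tle_root X z x0) (nesym x0z).
have Ea : branch_ram z x0 a.
  by split=> //; exact: (branch_down wd Ux0 ax0).
(* A point of the same order strictly below [a]: sending [a] to it makes the homeomorphism
   nontrivial. *)
have [b [Eb ba _ [bla nba]]] :=
  branch_dense wd Ea (@tle_root X z a) (nesym az) Ea.2.
have [phi [psi [I phia]]] := branch_iso_ex wd Ea Eb (esym ba).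
have Eex : exists c, branch_ram z x0 c by exists a.
have I' := branch_iso_sym I.
have [f extf] := extends_ex wd I Eex.
have [g extg] := extends_ex wd I' Eex.
exists f; split; last by case: extf.
  split; first exact: (extends_continuous wd I Eex extf extg).
  exists g; split; first exact: (extends_continuous wd I' Eex extg extf).
    exact: (extends_cancel wd I Eex extf extg).
  exact: (extends_cancel wd I' Eex extg extf).
move=> fid; apply: nba; rewrite -phia -(extends_eq wd I extf Ea) fid.
by [].
Qed.

(** The [z n] descend along one arc from [y] towards [x]. Having three components, [z n] has one
    that contains neither end. The one chosen at [z m] lies above [z m], hence for [m < n] in the
    component of [y] at [z n], so it is disjoint from the one chosen there. *)
Lemma disjoint_branches : exists z w : nat -> X, (forall n, w n <> z n) /\
  forall m n t, cc (z m) (w m) t -> cc (z n) (w n) t -> m = n.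
Proof.
have [_ [x [y xy]] _ _] := wd.
have [e0 re0] := ram_exists xy.
have [e1 [[re1 _] e1x e1y _ e1ly]] := dense_ram wd re0 (@tle_root X x y) xy.
pose good e := [/\ ramification_point e, e <> x, e <> y & tle x e y].
have /choice[next nextP] : forall e, exists e', good e ->
    [/\ good e', tle x e' e & e' <> e].
  move=> e; have [[re ex ey ely]|ng] := pselect (good e); last by exists e.
  have [e' [[re' _] e'x e'e _ e'le]] :=
    dense_ram wd re (@tle_root X x e) (nesym ex).
  exists e' => _; split=> //; split=> //; last exact: tle_trans e'le ely.
  by move=> e'y; apply: e'e; apply: tle_antisym e'le _ => //; rewrite e'y.
pose z n := iter n next e1.
have zg n : good (z n).
  by elim: n => [|n /nextP[]]; first by split.
have zle m n : (m < n)%N -> tle x (z n) (z m) /\ z n <> z m.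
  elim: n => // n IH; rewrite ltnS leq_eqVlt => /orP[/eqP ->|/IH[nm nnm]].
    by have [_ ? ?] := nextP _ (zg n).
  have [_ le1 ne1] := nextP _ (zg n); split; first exact: tle_trans le1 nm.
  move=> E; apply: nnm; apply: tle_antisym nm _ => //.
  by rewrite -E.
have /choice[w wP] : forall n, exists w, w <> z n /\
    ~ cc (z n) x w /\ ~ cc (z n) y w.
  move=> n; have [rz zx zy _] := zg n.
  have [a [b [c [[az bz cz] [ab ac bc]]]]] := ram_triple rz.
  have tr u v v' : cc (z n) u v -> cc (z n) u v' -> cc (z n) v v'.
    by move=> uv; apply: cc_trans; exact: cc_sym.
  apply: contrapT => nex.
  have H v : v <> z n -> cc (z n) x v \/ cc (z n) y v.
    move=> vz; apply: contrapT => /not_orP[? ?]; apply: nex; exists v.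
    by split.
  have [xa|ya] := H _ az; have [xb|yb] := H _ bz; have [xc|yc] := H _ cz;
    by [apply: ab; apply: tr; eassumption|apply: ac; apply: tr; eassumption|
        apply: bc; apply: tr; eassumption].
exists z, w; split; first by move=> n; have [] := wP n.
have disj m n t : (m < n)%N -> cc (z m) (w m) t -> cc (z n) (w n) t -> False.
  move=> mn tm tn; have [nm nnm] := zle _ _ mn.
  have [_ [xm _]] := wP m; have [_ [_ yn]] := wP n.
  have [_ _ _ my] := zg m.
  have mt : tle x (z m) t by apply: cc_tle tm _.
  apply: yn; apply: cc_trans (cc_sym tn).
  exact: (tle_cc cT lc hX nm (nesym nnm) my mt).
move=> m n t tm tn; have [mn|nm|//] := ltngtP m n.
  by case: (disj m n t).
by case: (disj n m t).
Qed.

End DisjointBranches.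

Theorem lemma2p8 (R : realType) (P : set order_value) (W : topologicalType) :
  P !=set0 ->
  P `<=` [set p | at_least3 p] ->
  wazewski_dendrite R P W ->
  rigid (@Homeo W).
Proof.
move=> P0 P3 wd; have [z [w [wz disj]]] := disjoint_branches P0 wd.
have /choice[g gP] n := branch_homeo P0 wd (wz n).
exists g; split.
  move=> n; have [hg gid _] := gP n; split=> //.
  by apply: subset_closure.
apply/cvg_sup => x U [V [[B oB <-] Bx BV]].
have [[n0 n0x]|nx] := pselect (exists n, cc (z n) (w n) x).
  (* Past the only index whose branch contains [x], every [g n] fixes [x]. *)
  exists n0.+1 => // n /= n0n; apply: BV => /=.
  have [_ _ ->//] := gP n => nx; have := disj _ _ _ n0x nx.
  by move=> E; rewrite E ltnn in n0n.
exists 0%N => // n _; apply: BV => /=.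
by have [_ _ ->//] := gP n => nx'; apply: nx; exists n.
Qed.
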